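(* Let $A(\nabla)=(a_1(\nabla),a_2(\nabla),a_3(\nabla))$ be any polynomial operator perpendicular to $\nabla$ (see context). For $n=1,2,\dots$ let $\lambda_n\ge0$ be an eigenvalue and $\psi_n$ a corresponding real eigenfunction of the periodic problem $$-\Delta\psi=\lambda_n^2\psi\ \text{ in }\mathbb{R}^3,\qquad \psi(x+2\pi)=\psi(x)\ \ \forall x\in\mathbb{R}^3,$$ and put $\phi_n=\lambda_n\psi_n$. (i) Let $$u_e^n(x)=A(\nabla)\phi_n(x)+\{A(\nabla)\times\nabla\}\psi_n(x)=\lambda_nA(\nabla)\psi_n(x)+\{A(\nabla)\times\nabla\}\psi_n(x).$$ Then for every $n$, $u=u_e^n$ is a solution of the static incompressible Euler equations $(u\cdot\nabla)u+\nabla P=0$, $\nabla\cdot u=0$ in $\mathbb{R}^3$ (for some scalar pressure $P$) with periodic boundary condition $u(x+2\pi)=u(x)$ for all $x\in\mathbb{R}^3$. (ii) Let $\nu>0$ and $$u_{ns}^n(t,x)=e^{-\nu\lambda_n^2t}A(\nabla)\phi_n(x)+e^{-\nu\lambda_n^2t}\{A(\nabla)\times\nabla\}\psi_n(x)=\lambda_ne^{-\nu\lambda_n^2t}A(\nabla)\psi_n(x)+e^{-\nu\lambda_n^2t}\{A(\nabla)\times\nabla\}\psi_n(x).$$ Then for every $n$, $u=u_{ns}^n$ is a solution of the incompressible Navier-Stokes equations $u_t-\nu\Delta u+(u\cdot\nabla)u+\nabla P=0$, $\nabla\cdot u=0$ (for some scalar pressure $P(t,x)$) with periodic boundary condition $u(t,x+2\pi)=u(t,x)$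 for all $t\ge0$, $x\in\mathbb{R}^3$, and initial data $u(t,x)|_{t=0}=u_e^n(x)$.
   Context: Notation: $\nabla=(\partial_1,\partial_2,\partial_3)$, $\partial_j=\partial/\partial x_j$. The condition $f(x+2\pi)=f(x)$ means that $f$ is $2\pi$-periodic in each of $x_1,x_2,x_3$. A polynomial operator perpendicular to $\nabla$ is $A(\nabla)=(p_1(\nabla),p_2(\nabla),p_3(\nabla))$, where $p_1,p_2,p_3$ are polynomials (with real coefficients) on $\mathbb{R}^3$ satisfying $x_1p_1(x)+x_2p_2(x)+x_3p_3(x)\equiv0$, and $p_j(\nabla)$ is the constant-coefficient differential operator obtained by substituting $\partial_k$ for $x_k$ (Fourier symbol $p_j(i\xi)$). Write $A(\nabla)\psi=(a_1(\nabla)\psi,a_2(\nabla)\psi,a_3(\nabla)\psi)$ and $$\{A(\nabla)\times\nabla\}\psi=\big((a_2(\nabla)\partial_3-a_3(\nabla)\partial_2)\psi,\ (a_3(\nabla)\partial_1-a_1(\nabla)\partial_3)\psi,\ (a_1(\nabla)\partial_2-a_2(\nabla)\partial_1)\psi\big).$$ The eigenvalues of the periodic problem are listed as $0\le\lambda_1\le\lambda_2\le\cdots$; $\lambda$ is called an eigenvalue if $-\Delta\psi=\lambda^2\psi$ has a nonzero periodic solution. *)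

(* Defs.v *)
From HB Require Import structures.
From mathcomp Require Import all_boot all_order all_algebra.
From mathcomp Require Import all_classical all_reals all_analysis.
(* The polynomial library is not imported: its notations clash with those of
   the analysis library, hence the qualified names below. *)
From mathcomp Require mpoly.

Set Implicit Arguments.
Unset Strict Implicit.
Unset Printing Implicit Defensive.

Import Order.TTheory GRing.Theory Num.Theory.
Import numFieldNormedType.Exports.

Local Open Scope classical_set_scope.
Local Open Scope ring_scope.

(* Coordinates are numbered from 0: x_1, x_2, x_3 are x 0 i for i : 'I_3 equal
   to c1, c2, c3. *)
Definition c1 : 'I_3 := Ordinal (isT : (0 < 3)%N).
Definition c2 : 'I_3 := Ordinal (isT : (1 < 3)%N).
Definition c3 : 'I_3 := Ordinal (isT : (2 < 3)%N).

Section Calculus.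
Variable R : realType.
Implicit Types (f g : 'rV[R]_3 -> R) (u : 'rV[R]_3 -> 'rV[R]_3).

Definition evec (j : 'I_3) : 'rV[R]_3 := delta_mx 0 j.

Definition partial (j : 'I_3) f : 'rV[R]_3 -> R := fun x => 'D_(evec j) f x.

Definition component (i : 'I_3) u : 'rV[R]_3 -> R := fun x => u x 0 i.

(* 'D_v is a total operator, with a meaningless value where the derivative does
   not exist; Ck asserts existence of the partial derivatives explicitly. *)
Fixpoint Ck (k : nat) f : Prop :=
  if k is k'.+1 then
    continuous f /\
    (forall j, (forall x, derivable f x (evec j)) /\ Ck k' (partial j f))
  else continuous f.

Definition laplacian f : 'rV[R]_3 -> R :=
  fun x => \sum_(j < 3) partial j (partial j f) x.

Definition gradient f : 'rV[R]_3 -> 'rV[R]_3 :=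
  fun x => \row_j partial j f x.

Definition divergence u : 'rV[R]_3 -> R :=
  fun x => \sum_(j < 3) partial j (component j u) x.

Definition vlaplacian u : 'rV[R]_3 -> 'rV[R]_3 :=
  fun x => \row_i laplacian (component i u) x.

(* (u . nabla) u *)
Definition advection u : 'rV[R]_3 -> 'rV[R]_3 :=
  fun x => \row_i \sum_(j < 3) u x 0 j * partial j (component i u) x.

Definition periodic_2pi (T : Type) (f : 'rV[R]_3 -> T) : Prop :=
  forall x (j : 'I_3), f (x + (2 * pi) *: evec j) = f x.

Definition dmonomial (m : mpoly.multinom 3) f : 'rV[R]_3 -> R :=
  let e := mpoly.fun_of_multinom m in
  iter (e c1) (partial c1) (iter (e c2) (partial c2) (iter (e c3) (partial c3) f)).

(* p(nabla) *)
Definition polyop (p : mpoly.mpoly 3 R) f : 'rV[R]_3 -> R :=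
  fun x => \sum_(m <- mpoly.msupp p) mpoly.mcoeff m p * dmonomial m f x.

(* x_1 p_1(x) + x_2 p_2(x) + x_3 p_3(x) = 0 on R^3 *)
Definition perpendicular (A : 'I_3 -> mpoly.mpoly 3 R) : Prop :=
  forall x : 'rV[R]_3, \sum_(j < 3) x 0 j * mpoly.meval (x 0) (A j) = 0.

(* A(nabla) f *)
Definition vecop (A : 'I_3 -> mpoly.mpoly 3 R) f : 'rV[R]_3 -> 'rV[R]_3 :=
  fun x => \row_j polyop (A j) f x.

(* {A(nabla) x nabla} f *)
Definition vecop_cross (A : 'I_3 -> mpoly.mpoly 3 R) f :
    'rV[R]_3 -> 'rV[R]_3 :=
  let a j k := polyop (A j) (partial k f) in
  fun x => \row_j nth 0 [:: a c2 c3 x - a c3 c2 x;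
                            a c3 c1 x - a c1 c3 x;
                            a c1 c2 x - a c2 c1 x] j.

(* Classical eigenfunctions: only C^2 is required.  By elliptic regularity they
   are smooth, so that the operators p(nabla) of any order make sense on them. *)
Definition eigenfunction (lambda : R) (psi : 'rV[R]_3 -> R) : Prop :=
  [/\ Ck 2 psi,
      exists x, psi x != 0,
      forall x, - laplacian psi x = lambda ^+ 2 * psi x &
      periodic_2pi psi].

Definition static_euler_solution u (P : 'rV[R]_3 -> R) : Prop :=
  [/\ forall i, Ck 1 (component i u),
      Ck 1 P,
      forall x, advection u x + gradient P x = 0 &
      forall x, divergence u x = 0].

Definition continuous_spacetime (f : R -> 'rV[R]_3 -> R) : Prop :=
  {within [set z : R * 'rV[R]_3 | 0 <= z.1],
     continuous (fun z : R * 'rV[R]_3 => f z.1 z.2)}.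

Definition dt (f : R -> 'rV[R]_3 -> R) : R -> 'rV[R]_3 -> R :=
  fun t x => derive1 (fun s => f s x) t.

(* Once differentiable in t and twice in x, with all these derivatives jointly
   continuous, for t >= 0.  At t = 0 the time derivative is two-sided, which is
   more than the one-sided derivative. *)
Definition C12 (f : R -> 'rV[R]_3 -> R) : Prop :=
  [/\ forall t, 0 <= t -> Ck 2 (f t),
      forall t x, 0 <= t -> derivable (fun s => f s x) t 1,
      continuous_spacetime f /\ continuous_spacetime (dt f),
      forall j, continuous_spacetime (fun t => partial j (f t)) &
      forall j k, continuous_spacetime (fun t => partial j (partial k (f t)))].

Definition navier_stokes_solution (nu : R) (u : R -> 'rV[R]_3 -> 'rV[R]_3)
    (P : R -> 'rV[R]_3 -> R) : Prop :=
  [/\ forall i, C12 (fun t => component i (u t)),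
      forall t, 0 <= t -> Ck 1 (P t),
      forall t x, 0 <= t ->
        (\row_i dt (fun s => component i (u s)) t x) - nu *: vlaplacian (u t) x
          + advection (u t) x + gradient (P t) x = 0 &
      forall t x, 0 <= t -> divergence (u t) x = 0].

End Calculus.

(* Main.v *)
Require Import Defs.
From mathcomp Require Import all_boot all_order all_algebra.
From mathcomp Require Import all_classical all_reals all_analysis.
From mathcomp Require Import measurable_realfun ring lra.
From mathcomp Require Import -(notations) ssrcomplements mpoly.
Import Order.TTheory GRing.Theory Num.Theory.
Import numFieldNormedType.Exports.
Set Implicit Arguments.
Unset Strict Implicit.
Unset Printing Implicit Defensive.
Local Open Scope classical_set_scope.
Local Open Scope ring_scope.

(** Put [h_i = a_i(nabla) psi].  Since [A] is perpendicular to [nabla], the field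
    [h] is divergence free ([divergence_free_polyop]); constant-coefficient
    operators commute with the Laplacian, so each [h_i] still satisfies
    [Delta h_i = - lambda^2 h_i] ([helmholtz_polyop]); and the cross product
    [{A x nabla} psi] is [- curl h].  The field of the theorem is therefore
    [u = lambda h - curl h].  For a divergence-free field
    [curl (curl h) = - Delta h = lambda^2 h], whence [curl u = - lambda u]: [u] is
    a Beltrami field ([beltrami_of_helmholtz]).

    For such a field the convective term is a gradient,
    [(u . nabla) u = nabla (|u|^2 / 2) + curl u x u] with [curl u x u = 0], so that
    [P = - |u|^2 / 2] solves the Euler equations.  Moreover
    [Delta u = - curl (curl u) = - lambda^2 u], so the factor
    [exp (- nu lambda^2 t)] makes the time derivative cancel the viscous term,
    while [exp (- nu lambda^2 t) u] stays a Beltrami field with its own pressure;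
    this gives the Navier-Stokes solution.

    The operators [a_i(nabla)] have arbitrary order whereas [psi] is only assumed
    to be of class C^2, so the analytic heart is the regularity theorem
    [eigenfunction_smooth].  It is obtained by Fourier analysis in one variable at
    a time, without multiple integrals.  The average of [f] against [cos (k s)]
    along the [j]-th coordinate, seen as a function on the whole space, commutes
    with all derivatives and is again an eigenfunction.  Averaging in all three
    directions makes every second derivative a scalar, which forces the average to
    vanish once [k^2 > lambda^2] ([favg_eigen_eq0]).  A continuous function is
    determined by its averages ([favg_eq0]), so [psi] is a finite linear
    combination of its averages of low frequency ([helmholtz_fourier]); doing this
    in the three directions writes [psi] as a finite linear combination of triple
    averages, whose partial derivatives are again triple averages ([Ck_favg3]). *)

(** * Integrals of continuous functions over a segment *)

Section OneVariable.
Variable R : realType.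
Implicit Types (h H : R -> R) (a b : R).

Definition itg a b h : R := (\int[lebesgue_measure]_(s in `[a, b]) h s)%R.

Lemma continuous_itg_integrable a b h : continuous h ->
  lebesgue_measure.-integrable `[a, b] (EFin \o h).
Proof.
move=> ch; apply: continuous_compact_integrable; first exact: segment_compact.
exact: continuous_subspaceT.
Qed.

Lemma itgD a b h H : continuous h -> continuous H ->
  itg a b (fun s => h s + H s) = itg a b h + itg a b H.
Proof.
by move=> ch cH; apply: RintegralD => //; exact: continuous_itg_integrable.
Qed.

Lemma itgZ a b r h : continuous h ->
  itg a b (fun s => r * h s) = r * itg a b h.
Proof. by move=> ch; apply: RintegralZl => //; exact: continuous_itg_integrable. Qed.

Lemma itg_cst a b r : a <= b -> itg a b (fun=> r) = r * (b - a).
Proof.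
move=> ab; rewrite /itg Rintegral_cst//= lebesgue_measure_itv/=.
case: ifPn => [_ //|]; rewrite lte_fin -leNgt => ba.
by rewrite (le_anti (introT andP (conj ab ba))) subrr.
Qed.

Lemma le_itg a b h H : continuous h -> continuous H ->
  (forall s, a <= s <= b -> h s <= H s) -> itg a b h <= itg a b H.
Proof.
move=> ch cH hH.
by apply: le_Rintegral => //; exact: continuous_itg_integrable.
Qed.

Lemma le_itg_sub a b a' b' h : a <= a' -> b' <= b -> continuous h ->
  (forall s, 0 <= h s) -> itg a' b' h <= itg a b h.
Proof.
move=> aa bb ch h0.
have fin x y : (\int[lebesgue_measure]_(s in `[x, y]) (h s)%:E)%E \is a fin_num.
  by have := continuous_itg_integrable x y ch; exact: integrable_fin_num.
apply: fine_le => //; apply: ge0_subset_integral => //.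
- apply/measurable_EFinP; apply: measurable_funTS.
  exact: continuous_measurable_fun.
- by move=> s _; rewrite lee_fin.
- move=> s/=; rewrite !in_itv/= => /andP[a's sb'].
  by rewrite (le_trans aa a's) (le_trans sb' bb).
Qed.

Lemma itg_derive a b h H : a < b -> continuous h ->
  (forall s : R, is_derive s 1 H (h s)) -> itg a b h = H b - H a.
Proof.
move=> ab ch dH; rewrite /itg /Rintegral.
have cH : continuous H.
  move=> s; apply: differentiable_continuous; apply/derivable1_diffP.
  by case: (dH s).
rewrite (@continuous_FTC2 _ h H)//.
- exact: continuous_subspaceT.
- split; first by move=> s _; case: (dH s).
  + by apply: cvg_at_right_filter; exact: cH.
  + by apply: cvg_at_left_filter; exact: cH.
- by move=> s _; rewrite derive1E; exact: derive_val.
Qed.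

Lemma norm_itg_le a b h e : a <= b -> continuous h ->
  (forall s, a <= s <= b -> `|h s| <= e) -> `|itg a b h| <= e * (b - a).
Proof.
move=> ab ch he; rewrite -itg_cst//.
apply: le_trans (le_normr_Rintegral _ _) _ => //.
  exact: continuous_itg_integrable.
apply: le_itg => //.
- move=> s; apply: continuous_comp; [exact: ch|exact: norm_continuous].
- by move=> s; apply: cvg_cst.
Qed.

Lemma continuous_uncurry_r (T : topologicalType) (F : T -> R -> R) y :
  continuous (fun z : T * R => F z.1 z.2) -> continuous (F y).
Proof.
move=> cF s; apply: (@cvg_comp _ _ _ (fun s => (y, s))
  (fun z : T * R => F z.1 z.2) _ (nbhs (y, s))); last exact: (cF (y, s)).
exact: (@cvg_pair _ _ _ (nbhs s) (nbhs y) (nbhs s) _ _ _ _ _ (cvg_cst _)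
  (@cvg_id _ _)).
Qed.

(** Compactness of the segment turns the joint continuity of the integrand into
    a bound on its variation that is uniform in the variable of integration. *)
Lemma itg_continuous_param (T : topologicalType) a b (F : T -> R -> R) :
  a <= b -> continuous (fun z : T * R => F z.1 z.2) ->
  continuous (fun x => itg a b (F x)).
Proof.
move=> ab cF x.
have cFx y : continuous (F y) by exact: continuous_uncurry_r.
apply/cvgrPdist_le => e e0.
have e1 : 0 < e / (b - a + 1).
  by rewrite divr_gt0// ltr_wpDl// subr_ge0.
pose close y s := `|F x s - F y s| <= e / (b - a + 1).
have /compact_near_coveringP/(_ _ (nbhs x) close) := @segment_compact R a b.
have H s : `[a, b]%classic s -> \forall t \near s & y \near nbhs x, close y t.
  move=> _.
  have e2 : 0 < e / (b - a + 1) / 2 by rewrite divr_gt0.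
  have /cvgrPdist_le/(_ _ e2) [[U V]/= [xU sV] UV] := cF (x, s).
  have /cvgrPdist_le/(_ _ e2) W := cFx x s.
  exists (V `&` [set t | `|F x s - F x t| <= e / (b - a + 1) / 2], U) => /=.
    by split => //; exact: filterI.
  move=> [t y]/= [[Vt xt] Uy].
  have := UV (y, t) (conj Uy Vt); rewrite /= => yt.
  rewrite /close (_ : F x t - F y t = (F x s - F y t) - (F x s - F x t)); last by ring.
  rewrite (le_trans (ler_normB _ _))// [leRHS]splitr lerD//.
move=> /(_ _ H) {H}; apply: filterS => y Hy /=.
have cD : continuous (fun s => F x s - F y s).
  by move=> s; apply: cvgB; exact: cFx.
have -> : itg a b (F x) - itg a b (F y) = itg a b (fun s => F x s - F y s).
  rewrite [RHS]itgD//; last by move=> s; apply: cvgN; exact: cFx.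
  congr (_ + _); rewrite -mulN1r -itgZ//; congr itg.
  by apply/funext => s; rewrite mulN1r.
apply: le_trans (norm_itg_le ab cD _) _.
  by move=> s sab; apply: Hy; rewrite /= in_itv.
rewrite -mulrAC ler_pdivrMr ?ltr_wpDl ?subr_ge0// ler_pM2l// lerDl//.
Qed.

(** A continuous derivative is bounded on a compact rectangle, and this constant
    dominates the difference quotients. *)
Lemma is_derive_itg_param a b (F dF : R -> R -> R) (t0 : R) :
  continuous (fun z : R * R => F z.1 z.2) ->
  continuous (fun z : R * R => dF z.1 z.2) ->
  (forall t s : R, is_derive t 1 (F^~ s) (dF t s)) ->
  is_derive t0 1 (fun t => itg a b (F t)) (itg a b (dF t0)).
Proof.
move=> cF cdF dFF.
have cs G := @continuous_uncurry_r R G.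
have [M HM] : exists M : R, forall t s,
    t0 - 1 <= t <= t0 + 1 -> a <= s <= b -> `|dF t s| <= M.
  have /compact_bounded[M [_ /(_ (M + 1))]] :
      compact ((fun z : R * R => dF z.1 z.2) @` (`[t0 - 1, t0 + 1] `*` `[a, b])).
    apply: continuous_compact; first exact: continuous_subspaceT.
    by apply: compact_setX; exact: segment_compact.
  rewrite ltrDl => /(_ ltr01) HM; exists (M + 1) => t s ht hs.
  by apply: HM => /=; exists (t, s) => //=; rewrite !in_itv.
have M0 (s : R) : 0 <= Num.max M 0 by rewrite le_max lexx orbT.
have t0I : `]t0 - 1, t0 + 1[%classic t0.
  by rewrite /= in_itv/= ltrDl ltrBlDr ltrDl ltr01.
have dE t s : partial1of2 F t s = dF t s.
  by rewrite partial1of2E; exact: derive_val.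
have := @cvg_differentiation_under_integral R _ _ lebesgue_measure F `[a, b]
  (measurable_itv _) t0 _ _ t0I _ _ (fun=> Num.max M 0) M0 _ _.
rewrite [X in _ --> X](_ : _ = itg a b (dF t0)); last first.
  by congr Rintegral; apply/funext => s; exact: dE.
move=> H; apply: DeriveDef.
  apply/cvg_ex; exists (itg a b (dF t0)).
  under eq_fun do rewrite scaler1.
  apply: H.
  - by move=> t _; apply: continuous_itg_integrable; exact: cs.
  - by move=> t s _ _; case: (dFF t s).
  - by apply: continuous_itg_integrable => s; exact: cvg_cst.
  - move=> t s; rewrite /= !in_itv/= => /andP[/ltW t1 /ltW t2] sab.
    by rewrite dE le_max HM// t1 t2.
rewrite -derive1E; apply/cvg_lim => //; apply: H.
  - by move=> t _; apply: continuous_itg_integrable; exact: cs.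
  - by move=> t s _ _; case: (dFF t s).
  - by apply: continuous_itg_integrable => s; exact: cvg_cst.
  - move=> t s; rewrite /= !in_itv/= => /andP[/ltW t1 /ltW t2] sab.
    by rewrite dE le_max HM// t1 t2.
Qed.

End OneVariable.

(** * Differential calculus on the space and averages along a coordinate *)

Section Lines.
Variable R : realType.
Local Notation V := 'rV[R]_3.
Local Notation e := (@evec R).
Implicit Types (f : V -> R) (w : R -> R) (x v : V) (i j : 'I_3).

Lemma continuous_add (T : topologicalType) (g h : T -> R) :
  continuous g -> continuous h -> continuous (fun t => g t + h t).
Proof. by move=> cg ch t; exact: (cvgD (cg t) (ch t)). Qed.

Lemma continuous_mul (T : topologicalType) (g h : T -> R) :
  continuous g -> continuous h -> continuous (fun t => g t * h t).
Proof. by move=> cg ch t; exact: (cvgM (cg t) (ch t)). Qed.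

(** Directional derivatives are one-variable derivatives along a line, which is
    how the one-variable integration theory applies to functions on the space. *)
Lemma is_derive_line f x v (s d : R) :
  is_derive s 1 (fun t => f (x + t *: v)) d <-> is_derive (x + s *: v) v f d.
Proof.
have E : (fun h : R => h^-1 *: (f (x + (h *: 1 + s) *: v) - f (x + s *: v))) =
         (fun h : R => h^-1 *: (f (h *: v + (x + s *: v)) - f (x + s *: v))).
  apply/funext => h; congr (_ *: (f _ - _)).
  by rewrite [h *: 1]mulr1 scalerDl addrCA.
split=> -[D Dd]; apply: DeriveDef.
- by move: D; rewrite /derivable /= E.
- by move: Dd; rewrite /derive /= E.
- by move: D; rewrite /derivable /= E.
- by move: Dd; rewrite /derive /= E.
Qed.

Lemma is_derive_partial f j x : derivable f x (e j) ->
  is_derive x (e j) f (partial j f x).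
Proof. by move=> df; apply: DeriveDef. Qed.

Lemma continuous_line (v : V) f : continuous f ->
  continuous (fun z : V * R => f (z.1 + z.2 *: v)).
Proof.
move=> cf z; apply: (@cvg_comp _ _ _ (fun z : V * R => z.1 + z.2 *: v) f _
  (nbhs (z.1 + z.2 *: v))); last exact: cf.
apply: cvgD; first exact: cvg_fst.
by apply: cvgZr_tmp; exact: cvg_snd.
Qed.

Lemma is_derive_at_line f x v (d : R) :
  is_derive (0 : R) 1 (fun t : R => f (x + t *: v)) d <-> is_derive x v f d.
Proof. by rewrite is_derive_line scale0r addr0. Qed.

Lemma partialE f j x (d : R) : is_derive x (e j) f d -> partial j f x = d.
Proof. by move=> fd; rewrite /partial; exact: derive_val. Qed.

Lemma Ck_continuous k f : Ck k f -> continuous f.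
Proof. by case: k => [|k] //= []. Qed.

Lemma Ck_derivable k f j x : Ck k.+1 f -> derivable f x (e j).
Proof. by move=> [_ /(_ j)[]]. Qed.

Lemma Ck_partial k f j : Ck k.+1 f -> Ck k (partial j f).
Proof. by move=> [_ /(_ j)[]]. Qed.

Lemma Ck_is_derive k f j x : Ck k.+1 f -> is_derive x (e j) f (partial j f x).
Proof. by move=> kf; apply: is_derive_partial; exact: Ck_derivable kf. Qed.

Lemma CkS k f : Ck k.+1 f -> Ck k f.
Proof.
elim: k f => [|k IH] f; first by case.
move=> kf; split; first exact: Ck_continuous kf.
move=> j; split=> [x|]; first exact: Ck_derivable kf.
by apply: IH; exact: Ck_partial kf.
Qed.

(** The usual way to prove regularity below: exhibit the partial derivatives and
    prove them regular. *)
Lemma CkSI k f (df : 'I_3 -> V -> R) : continuous f ->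
  (forall j x, is_derive x (e j) f (df j x)) -> (forall j, Ck k (df j)) ->
  Ck k.+1 f.
Proof.
move=> cf fdf kdf; split=> // j; split=> [x|]; first by case: (fdf j x).
by rewrite (_ : partial j f = df j)//; apply/funext => x; exact: partialE.
Qed.

Lemma CkD k f g : Ck k f -> Ck k g -> Ck k (fun x => f x + g x).
Proof.
elim: k f g => [|k IH] f g kf kg; first by
  apply: continuous_add; [exact: Ck_continuous kf|exact: Ck_continuous kg].
apply: (@CkSI _ _ (fun j x => partial j f x + partial j g x)).
- by apply: continuous_add; [exact: Ck_continuous kf|exact: Ck_continuous kg].
- by move=> j x; apply: is_deriveD; [exact: Ck_is_derive kf|exact: Ck_is_derive kg].
- by move=> j; apply: IH; [exact: Ck_partial kf|exact: Ck_partial kg].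
Qed.

Lemma CkM k f g : Ck k f -> Ck k g -> Ck k (fun x => f x * g x).
Proof.
elim: k f g => [|k IH] f g kf kg; first by
  apply: continuous_mul; [exact: Ck_continuous kf|exact: Ck_continuous kg].
apply: (@CkSI _ _ (fun j x => f x * partial j g x + g x * partial j f x)).
- by apply: continuous_mul; [exact: Ck_continuous kf|exact: Ck_continuous kg].
- by move=> j x; apply: is_deriveM; [exact: Ck_is_derive kf|exact: Ck_is_derive kg].
- by move=> j; apply: CkD; apply: IH;
    [exact: CkS|exact: Ck_partial kg|exact: CkS|exact: Ck_partial kf].
Qed.

Lemma Ck_cst k (c : R) : Ck k (fun _ : V => c).
Proof.
elim: k c => [|k IH] c; first exact: cst_continuous.
apply: (@CkSI _ _ (fun _ _ => 0)) => [|j]; [exact: cst_continuous|exact: IH].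
Qed.

Lemma CkZ k c f : Ck k f -> Ck k (fun x => c * f x).
Proof. by move=> kf; apply: CkM => //; exact: Ck_cst. Qed.

Lemma Ck_sum k (I : Type) (r : seq I) (F : I -> V -> R) :
  (forall n, Ck k (F n)) -> Ck k (fun x => \sum_(n <- r) F n x).
Proof.
move=> kF; elim: r => [|n r IH].
  by under eq_fun do rewrite big_nil; exact: Ck_cst.
by under eq_fun do rewrite big_cons; exact: CkD.
Qed.

Lemma partialD f g j : Ck 1 f -> Ck 1 g ->
  partial j (fun x => f x + g x) = (fun x => partial j f x + partial j g x).
Proof.
move=> kf kg; apply/funext => x; apply: partialE.
by apply: is_deriveD; [exact: Ck_is_derive kf|exact: Ck_is_derive kg].
Qed.

Lemma partialM f g j : Ck 1 f -> Ck 1 g ->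
  partial j (fun x => f x * g x) =
  (fun x => f x * partial j g x + g x * partial j f x).
Proof.
move=> kf kg; apply/funext => x; apply: partialE.
by apply: is_deriveM; [exact: Ck_is_derive kf|exact: Ck_is_derive kg].
Qed.

Lemma partial_cst (c : R) j : partial j (fun _ : V => c) = (fun=> 0).
Proof. by apply/funext => x; apply: partialE; exact: is_derive_cst. Qed.

Lemma partialZ c f j : Ck 1 f ->
  partial j (fun x => c * f x) = (fun x => c * partial j f x).
Proof.
move=> kf; rewrite (partialM _ (Ck_cst 1 c))// partial_cst.
by apply/funext => x; rewrite mulr0 addr0.
Qed.

Lemma partial_sum (I : Type) (r : seq I) (F : I -> V -> R) j :
  (forall n, Ck 1 (F n)) -> partial j (fun x => \sum_(n <- r) F n x) =
  (fun x => \sum_(n <- r) partial j (F n) x).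
Proof.
move=> kF; elim: r => [|n r IH].
  under eq_fun do rewrite big_nil; rewrite partial_cst.
  by apply/funext => x; rewrite big_nil.
under eq_fun do rewrite big_cons.
rewrite partialD//; last exact: Ck_sum.
by apply/funext => x; rewrite big_cons IH.
Qed.

Lemma periodic_partial f j : periodic_2pi f -> periodic_2pi (partial j f).
Proof.
move=> pf x i; rewrite /partial /derive.
suff -> : (fun h : R => h^-1 *: (f (h *: e j + (x + (2 * pi) *: e i)) -
                               f (x + (2 * pi) *: e i))) =
  (fun h : R => h^-1 *: (f (h *: e j + x) - f x)) by [].
by apply/funext => h; rewrite addrA !pf.
Qed.

(** The integral is kept as a function of the base point [x], so that averages in
    different directions can be composed. *)
Definition line_itg a b w j f : V -> R :=
  fun x => itg a b (fun s => f (x + s *: e j) * w s).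

Lemma continuous_integrand2 w j f : continuous w -> continuous f ->
  continuous (fun z : V * R => f (z.1 + z.2 *: e j) * w z.2).
Proof.
move=> cw cf; apply: continuous_mul; first exact: continuous_line.
move=> z; exact: (@cvg_comp _ _ _ snd w (nbhs z) (nbhs z.2) _ cvg_snd (cw z.2)).
Qed.

Lemma continuous_integrand w j f x : continuous w -> continuous f ->
  continuous (fun s : R => f (x + s *: e j) * w s).
Proof.
move=> cw cf; have := continuous_integrand2 (j := j) cw cf.
exact: (@continuous_uncurry_r R V (fun (y : V) (s : R) => f (y + s *: e j) * w s) x).
Qed.

Lemma continuous_line_itg a b w j f : a <= b -> continuous w -> continuous f ->
  continuous (line_itg a b w j f).
Proof.
by move=> ab cw cf; apply: itg_continuous_param => //; exact: continuous_integrand2.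
Qed.

Lemma is_derive_line_itg a b w j i f df x : continuous w -> continuous f ->
  continuous df -> (forall y, is_derive y (e i) f (df y)) ->
  is_derive x (e i) (line_itg a b w j f) (line_itg a b w j df x).
Proof.
move=> cw cf cdf fdf; apply/is_derive_at_line.
have ct (g : V -> R) : continuous g -> continuous (fun z : R * R =>
    g ((x + z.1 *: e i) + z.2 *: e j) * w z.2).
  move=> cg z; apply: (@cvg_comp _ _ _ (fun z : R * R => (x + z.1 *: e i, z.2))
    (fun z : V * R => g (z.1 + z.2 *: e j) * w z.2) _ (nbhs (x + z.1 *: e i, z.2))).
    apply: (@cvg_pair _ _ _ _ (nbhs (x + z.1 *: e i)) (nbhs z.2));
      last exact: cvg_snd.
    apply: cvgD; first exact: cvg_cst.
    by apply: cvgZr_tmp; exact: cvg_fst.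
  exact: (@continuous_integrand2 w j g cw cg (x + z.1 *: e i, z.2)).
have -> : line_itg a b w j df x =
    itg a b (fun s => df (x + 0 *: e i + s *: e j) * w s).
  by rewrite scale0r addr0.
apply: (@is_derive_itg_param R a b (fun t s => f (x + t *: e i + s *: e j) * w s)
  (fun t s => df (x + t *: e i + s *: e j) * w s)); [exact: ct|exact: ct|].
move=> t s; rewrite [X in is_derive _ _ _ X]mulrC.
have D : is_derive t 1 (fun t : R => f (x + t *: e i + s *: e j))
    (df (x + t *: e i + s *: e j)).
  under eq_fun do rewrite addrAC.
  by apply/is_derive_line; rewrite addrAC.
have := @is_deriveM _ _ _ _ _ _ _ _ D (is_derive_cst (w s) t 1).
by rewrite scaler0 add0r.
Qed.

Lemma Ck_line_itg k a b w j f : a <= b -> continuous w -> Ck k f ->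
  Ck k (line_itg a b w j f).
Proof.
move=> ab cw; elim: k f => [|k IH] f kf; first exact: continuous_line_itg.
apply: (@CkSI _ _ (fun i => line_itg a b w j (partial i f))).
- by apply: continuous_line_itg => //; exact: Ck_continuous kf.
- move=> i x; apply: is_derive_line_itg => //; first exact: Ck_continuous kf.
    by apply: (@Ck_continuous k); exact: Ck_partial.
  by move=> y; exact: Ck_is_derive kf.
- by move=> i; apply: IH; exact: Ck_partial.
Qed.

Lemma partial_line_itg a b w j i f : continuous w -> Ck 1 f ->
  partial i (line_itg a b w j f) = line_itg a b w j (partial i f).
Proof.
move=> cw kf; apply/funext => x; apply: partialE; apply: is_derive_line_itg => //.
- exact: Ck_continuous kf.
- by have := Ck_partial i kf.
- by move=> y; exact: Ck_is_derive kf.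
Qed.

(** Schwarz's theorem.  Differentiating
    [f (y + t e_j) - f (y - e_j) = int_(-1)^t (d_j f) (y + s e_j) ds] with respect
    to [y] in the direction [i] gives the same identity for [d_i f], with
    integrand [d_i d_j f]; its derivative in [t] at [0] is [d_j d_i f]. *)
Lemma partial_comm f i j : Ck 2 f ->
  partial i (partial j f) = partial j (partial i f).
Proof.
move=> kf; apply/funext => x.
have kj := Ck_partial j kf; have ki := Ck_partial i kf.
have cij : continuous (partial i (partial j f)) by have := Ck_partial i kj.
pose F (t : R) := itg (-1) t (fun s => partial i (partial j f) (x + s *: e j) * 1).
have FE t : -1 < t ->
    F t = partial i f (x + t *: e j) - partial i f (x + (-1) *: e j).
  move=> t1; have D y : f (y + t *: e j) - f (y + (-1) *: e j) =
      line_itg (-1) t (fun=> 1) j (partial j f) y.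
    symmetry; apply: (@itg_derive R (-1) t (fun s => partial j f (y + s *: e j) * 1)
      (fun s => f (y + s *: e j))) => //.
      apply: continuous_integrand; last exact: Ck_continuous kj.
      exact: cst_continuous.
    by move=> s; rewrite mulr1; apply/is_derive_line; exact: Ck_is_derive kf.
  have -> : F t = line_itg (-1) t (fun=> 1) j (partial i (partial j f)) x by [].
  rewrite -partial_line_itg//; last exact: cst_continuous.
  apply: partialE; rewrite (_ : line_itg _ _ _ _ _ =
    fun y => f (y + t *: e j) - f (y + (-1) *: e j)); last first.
    by apply/funext => y; rewrite D.
  have sh (s : R) : is_derive x (e i) (fun y => f (y + s *: e j))
      (partial i f (x + s *: e j)).
    apply/is_derive_at_line.
    under eq_fun do rewrite addrAC.
    by apply/is_derive_at_line; exact: Ck_is_derive kf.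
  by apply: is_deriveB.
have cG : continuous (fun s : R => partial i (partial j f) (x + s *: e j) * 1).
  by apply: continuous_integrand => //; exact: cst_continuous.
have [FD F0] := @continuous_FTC1_closed R
  (fun s => partial i (partial j f) (x + s *: e j) * 1) (-1) 0 1 ltr01
  (continuous_itg_integrable (-1) 1 cG) ltac:(by rewrite oppr_lt0) (cG 0).
have G0 : partial i (partial j f) x = partial i (partial j f) (x + 0 *: e j) * 1.
  by rewrite scale0r addr0 mulr1.
apply/esym; apply: partialE; apply/is_derive_at_line.
rewrite [X in is_derive _ _ _ X]G0 -F0 derive1E.
pose c := partial i f (x + (-1) *: e j).
have : is_derive (0:R) 1 (fun t : R => F t + c) ('D_1 F 0).
  rewrite -[X in is_derive _ _ _ X]addr0.
  by apply: is_deriveD; exact: DeriveDef.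
apply: near_eq_is_derive; near=> t.
by rewrite FE ?subrK//; near: t; apply: lt_nbhsr; rewrite oppr_lt0.
Unshelve. all: by end_near. Qed.

End Lines.

(** * Fourier averages along one coordinate *)

Section Fourier.
Variable R : realType.
Local Notation V := 'rV[R]_3.
Local Notation e := (@evec R).
Implicit Types (f : V -> R) (w : R -> R) (x v : V) (i j : 'I_3) (k l : nat).

Definition trig k (a b : R) : R -> R :=
  fun s => a * cos (k%:R * s) + b * sin (k%:R * s).

Lemma is_derive_linear (c s : R) : is_derive s 1 (fun t : R => c * t) c.
Proof.
have := is_deriveM (is_derive_cst c s 1) (is_derive_id s 1).
by rewrite scaler0 addr0 [c *: _]mulr1.
Qed.

Lemma is_derive_cosZ (c s : R) :
  is_derive s 1 (fun t : R => cos (c * t)) (- sin (c * s) * c).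
Proof.
exact: (@is_derive1_comp _ cos (fun t => c * t) s _ _ (is_derive_cos _)
  (is_derive_linear c s)).
Qed.

Lemma is_derive_sinZ (c s : R) :
  is_derive s 1 (fun t : R => sin (c * t)) (cos (c * s) * c).
Proof.
exact: (@is_derive1_comp _ sin (fun t => c * t) s _ _ (is_derive_sin _)
  (is_derive_linear c s)).
Qed.

Lemma is_derive_mulr (g h : R -> R) (s dg dh : R) :
  is_derive s 1 g dg -> is_derive s 1 h dh ->
  is_derive s 1 (fun t : R => g t * h t) (g s * dh + h s * dg).
Proof. by move=> Dg Dh; exact: is_deriveM. Qed.

Lemma is_derive_cmul (c : R) (h : R -> R) (s dh : R) :
  is_derive s 1 h dh -> is_derive s 1 (fun t : R => c * h t) (c * dh).
Proof. by move=> Dh; exact: (@is_deriveZ _ _ _ h c s 1 dh Dh). Qed.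

Lemma is_derive_addr (g h : R -> R) (s dg dh : R) :
  is_derive s 1 g dg -> is_derive s 1 h dh ->
  is_derive s 1 (fun t : R => g t + h t) (dg + dh).
Proof. by move=> Dg Dh; exact: is_deriveD. Qed.

Lemma is_derive_continuous (g dg : R -> R) :
  (forall s : R, is_derive s 1 g (dg s)) -> continuous g.
Proof.
move=> D s; apply: differentiable_continuous; apply/derivable1_diffP.
by case: (D s).
Qed.

Lemma is_derive_trig k a b (s : R) :
  is_derive s 1 (trig k a b) (trig k (k%:R * b) (- (k%:R * a)) s).
Proof.
have -> : trig k (k%:R * b) (- (k%:R * a)) s =
    a * (- sin (k%:R * s) * k%:R) + b * (cos (k%:R * s) * k%:R).
  by rewrite /trig; ring.
apply: is_derive_addr; apply: is_derive_cmul.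
  exact: is_derive_cosZ.
exact: is_derive_sinZ.
Qed.

Lemma continuous_trig k a b : continuous (trig k a b).
Proof. exact: is_derive_continuous (is_derive_trig k a b). Qed.

Lemma sin_natpi k : sin (k%:R * pi : R) = 0.
Proof.
elim: k => [|k IH]; first by rewrite mul0r sin0.
by rewrite -natr1 mulrDl mul1r sinDpi IH oppr0.
Qed.

Lemma trigNpi k a b : trig k a b (- pi) = trig k a b pi.
Proof. by rewrite /trig mulrN cosN sinN sin_natpi oppr0. Qed.

Lemma Npi_lt_pi : - pi < pi :> R.
Proof. by have := pi_gt0 R; lra. Qed.

Lemma periodic_Npi f x j : periodic_2pi f ->
  f (x + (- pi) *: e j) = f (x + pi *: e j).
Proof.
move=> pf; rewrite -(pf (x + _) j) -addrA -scalerDl; congr (f (x + _ *: _)); ring.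
Qed.

(** The boundary terms cancel by periodicity of [f] and of the weight. *)
Lemma line_itg_by_parts (w dw : R -> R) j f x :
  (forall s : R, is_derive s 1 w (dw s)) ->
  continuous dw -> w (- pi) = w pi -> Ck 1 f -> periodic_2pi f ->
  line_itg (- pi) pi w j (partial j f) x = - line_itg (- pi) pi dw j f x.
Proof.
move=> D cdw wpi kf pf; have cw := is_derive_continuous D.
have c1 := continuous_integrand (j := j) (x := x) cw
  (Ck_continuous (Ck_partial j kf)).
have c2 := continuous_integrand (j := j) (x := x) cdw (Ck_continuous kf).
apply/eqP; rewrite -addr_eq0 -itgD//; apply/eqP.
have DD (s : R) : is_derive s 1 (fun s : R => f (x + s *: e j) * w s)
    (partial j f (x + s *: e j) * w s + f (x + s *: e j) * dw s).
  rewrite [X in is_derive _ _ _ X]addrC [partial _ _ _ * _]mulrC;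
    apply: is_derive_mulr.
  by apply/is_derive_line; exact: Ck_is_derive kf.
by rewrite (itg_derive Npi_lt_pi (continuous_add c1 c2) DD) periodic_Npi// wpi subrr.
Qed.

Lemma periodic_line_itg a b w j f : periodic_2pi f ->
  periodic_2pi (line_itg a b w j f).
Proof.
by move=> pf x i; congr itg; apply/funext => s; rewrite addrAC pf.
Qed.

(** Up to normalization, [favg k 1 0 j f x] and [favg k 0 1 j f x] are the cosine
    and sine coefficients of order [k] of [f] on the line through [x] in the
    direction [j].  The weight is a general combination because differentiation in
    the direction [j] exchanges sines and cosines. *)
Definition favg k a b j f := line_itg (- pi) pi (trig k a b) j f.

Lemma Ck_favg n k a b j f : Ck n f -> Ck n (favg k a b j f).
Proof.
move=> nf; apply: Ck_line_itg => //; last exact: continuous_trig.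
exact/ltW/Npi_lt_pi.
Qed.

Lemma periodic_favg k a b j f : periodic_2pi f -> periodic_2pi (favg k a b j f).
Proof. exact: periodic_line_itg. Qed.

Lemma partial_favg k a b j i f : Ck 1 f ->
  partial i (favg k a b j f) = favg k a b j (partial i f).
Proof. by move=> kf; apply: partial_line_itg => //; exact: continuous_trig. Qed.

Lemma favgN k a b j f x : continuous f ->
  - favg k a b j f x = favg k (- a) (- b) j f x.
Proof.
move=> cf; rewrite -mulN1r -[LHS]itgZ; last first.
  by apply: continuous_integrand => //; exact: continuous_trig.
by congr itg; apply/funext => s; rewrite /trig; ring.
Qed.

(** Differentiation along the direction of the average only acts on the weight, so
    it costs no regularity. *)
Lemma favg_partial k a b j f : Ck 1 f -> periodic_2pi f ->
  favg k a b j (partial j f) = favg k (- (k%:R * b)) (k%:R * a) j f.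
Proof.
move=> kf pf; apply/funext => x.
rewrite [LHS](line_itg_by_parts j x (is_derive_trig k a b)
  (@continuous_trig _ _ _) (trigNpi k a b) kf pf).
by rewrite [LHS]favgN ?opprK//; exact: Ck_continuous kf.
Qed.

Lemma favgZw k a b c j f x : continuous f ->
  favg k (c * a) (c * b) j f x = c * favg k a b j f x.
Proof.
move=> cf; rewrite -[RHS]itgZ; last first.
  by apply: continuous_integrand => //; exact: continuous_trig.
by congr itg; apply/funext => s; rewrite /trig; ring.
Qed.

Lemma partial2_favg k a b j f : Ck 1 f -> periodic_2pi f ->
  partial j (partial j (favg k a b j f)) = (fun x => - k%:R ^+ 2 * favg k a b j f x).
Proof.
move=> kf pf; rewrite partial_favg// favg_partial// partial_favg// favg_partial//.
apply/funext => x; rewrite -favgZw; last exact: Ck_continuous kf.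
by congr (favg _ _ _ _ _ x); ring.
Qed.

Lemma favg_partial2 k a b j f x : Ck 2 f -> periodic_2pi f ->
  favg k a b j (partial j (partial j f)) x = - k%:R ^+ 2 * favg k a b j f x.
Proof.
move=> kf pf; have k1 := CkS kf; have kj := Ck_partial j kf.
by rewrite -partial_favg// -partial_favg// partial2_favg.
Qed.

Lemma favgZ k a b j c f : continuous f ->
  favg k a b j (fun x => c * f x) = (fun x => c * favg k a b j f x).
Proof.
move=> cf; apply/funext => x; rewrite -[RHS]itgZ; last first.
  by apply: continuous_integrand => //; exact: continuous_trig.
by congr itg; apply/funext => s; rewrite mulrA.
Qed.

Lemma favgD k a b j f g : continuous f -> continuous g ->
  favg k a b j (fun x => f x + g x) = (fun x => favg k a b j f x + favg k a b j g x).
Proof.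
move=> cf cg; apply/funext => x; rewrite -[RHS]itgD.
- by congr itg; apply/funext => s; rewrite mulrDl.
- by apply: continuous_integrand => //; exact: continuous_trig.
- by apply: continuous_integrand => //; exact: continuous_trig.
Qed.

Lemma bernoulli_ineq (y : R) n : -1 <= y -> 1 + n%:R * y <= (1 + y) ^+ n.
Proof.
move=> y1; elim: n => [|n IH]; first by rewrite mul0r addr0 expr0.
rewrite exprS; have y2 : 0 <= 1 + y by lra.
apply: le_trans (ler_wpM2l y2 IH); rewrite -natr1.
have := mulr_ge0 (ler0n R n) (sqr_ge0 y); lra.
Qed.

Lemma continuous_cosX (c : R) n : continuous (fun s : R => (cos s + c) ^+ n).
Proof.
elim: n => [|n IH]; first by under eq_fun do rewrite expr0; exact: cst_continuous.
under eq_fun do rewrite exprS; apply: continuous_mul => //.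
by apply: continuous_add; [exact: continuous_cos|exact: cst_continuous].
Qed.

(** Powers of [cos s + c] are trigonometric polynomials in [s]; this form of the
    statement is stable under the product-to-sum formula. *)
Lemma favg0_pow f x j (c : R) : continuous f ->
  (forall k, favg k 1 0 j f x = 0) -> forall n k,
  itg (- pi) pi (fun s => f (x + s *: e j) * (cos (k%:R * s) * (cos s + c) ^+ n)) = 0.
Proof.
move=> cf f0; elim=> [|n IH] k.
  rewrite -[RHS](f0 k); congr itg; apply/funext => s.
  by rewrite /trig expr0 mulr1 mul1r mul0r addr0.
have cint m : continuous
    (fun s : R => f (x + s *: e j) * (cos (m%:R * s) * (cos s + c) ^+ n)).
  apply: (@continuous_integrand R (fun s => cos (m%:R * s) * (cos s + c) ^+ n)) => //.
  apply: continuous_mul; last exact: continuous_cosX.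
  by apply: (@is_derive_continuous _ (fun s => - sin (m%:R * s) * m%:R)) => s;
    exact: is_derive_cosZ.
have cintZ r m : continuous
    (fun s : R => r * (f (x + s *: e j) * (cos (m%:R * s) * (cos s + c) ^+ n))).
  by apply: continuous_mul => //; exact: cst_continuous.
(* [cos (k s) cos s] involves the frequency [k - 1], negative when [k = 0]. *)
case: k => [|k].
  have E : (fun s : R => f (x + s *: e j) * (cos (0%:R * s) * (cos s + c) ^+ n.+1)) =
     (fun s => f (x + s *: e j) * (cos (1%:R * s) * (cos s + c) ^+ n) +
               c * (f (x + s *: e j) * (cos (0%:R * s) * (cos s + c) ^+ n))).
    by apply/funext => s; rewrite exprS !mul0r cos0 !mul1r; ring.
  by rewrite E itgD// itgZ// !IH mulr0 addr0.
have E : (fun s : R => f (x + s *: e j) * (cos (k.+1%:R * s) * (cos s + c) ^+ n.+1)) =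
     (fun s => (2^-1 * (f (x + s *: e j) * (cos (k.+2%:R * s) * (cos s + c) ^+ n)) +
               2^-1 * (f (x + s *: e j) * (cos (k%:R * s) * (cos s + c) ^+ n))) +
               c * (f (x + s *: e j) * (cos (k.+1%:R * s) * (cos s + c) ^+ n))).
  apply/funext => s; rewrite exprS.
  have -> : k.+2%:R * s = k.+1%:R * s + s by rewrite -(natr1 k.+1); ring.
  have -> : k%:R * s = k.+1%:R * s - s by rewrite -(natr1 k); ring.
  by rewrite cosB cosD; field.
by rewrite E !itgD ?itgZ ?IH ?mulr0 ?addr0//; exact: continuous_add.
Qed.

End Fourier.

(** * Uniqueness of Fourier coefficients *)

Section Uniq.
Variable R : realType.
Local Notation V := 'rV[R]_3.
Local Notation e := (@evec R).
Implicit Types (f : V -> R) (w : R -> R) (x v : V) (i j : 'I_3) (k l : nat).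

Lemma cos_le_norm (s t : R) : `|s| <= `|t| -> `|t| <= pi -> cos t <= cos s.
Proof.
move=> st tpi; have ca (u : R) : cos `|u| = cos u.
  by case: (ger0P u) => // _; rewrite cosN.
rewrite -(ca s) -(ca t) leNgt ltr_cos ?in_itv/= ?normr_ge0 ?(le_trans st tpi)//.
by rewrite -leNgt.
Qed.

(** If [f x > 0], then for some [d] the function is at least [f x / 2] at the points
    [x + s e_j] with [|s| <= d].  With [c = 1 - cos d] the weight [cos s + c] is at
    least [1] there and bounded by [1] in absolute value on the rest of the period,
    so the integrals of [f] against its powers, which vanish, would grow at least
    linearly by Bernoulli's inequality. *)
Lemma favg_eq0 f x j : continuous f ->
  (forall k, favg k 1 0 j f x = 0) -> f x = 0.
Proof.
move=> cf f0.
wlog fx : f cf f0 / 0 < f x.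
  move=> H; apply/eqP; rewrite eq_le !leNgt; apply/andP; split; apply/negP => fx.
    by have := H f cf f0 fx => fx0; rewrite fx0 ltxx in fx.
  suff : -1 * f x = 0 by move=> fx0; lra.
  apply: (H (fun y => -1 * f y)).
  - by apply: continuous_mul => //; exact: cst_continuous.
  - by move=> k; rewrite favgZ// f0 mulr0.
  - by lra.
exfalso; pose g (s : R) := f (x + s *: e j).
have cg : continuous g.
  have c1 : continuous (fun _ : R => 1 : R) by exact: cst_continuous.
  have := @continuous_integrand R (fun=> 1) j f x c1 cf.
  by under eq_fun do rewrite mulr1.
have g0 : g 0 = f x by rewrite /g scale0r addr0.
have [d [d0 d1 gd]] : exists d : R,
    [/\ 0 < d, d <= 1 & forall s, `|s| <= d -> f x / 2 <= g s].
  have fx2 : 0 < f x / 2 by rewrite divr_gt0.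
  have /cvgrPdist_le/(_ _ fx2)/nbhs_ballP[r /= r0 gr] := cg 0.
  exists (Num.min (r / 2) 1); split.
  - by rewrite lt_min ltr01 divr_gt0.
  - by rewrite ge_min lexx orbT.
  - move=> s; rewrite le_min => /andP[sr _].
    have /gr : ball (0 : R) r s.
      rewrite /ball/= sub0r normrN (le_lt_trans sr)//.
      by rewrite ltr_pdivrMr// ltr_pMr// ltr1n.
    by rewrite /= g0 ler_norml => /andP[_]; lra.
have [M M0 gM] : exists2 M : R, 0 <= M & forall s, `|s| <= pi -> `|g s| <= M.
  have /compact_bounded[M [_ /(_ (`|M| + 1))]] : compact (g @` `[(- pi), pi]).
    apply: continuous_compact; first exact: continuous_subspaceT.
    exact: segment_compact.
  rewrite (le_lt_trans (ler_norm M)) ?ltrDl// => /(_ isT) HM.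
  exists (`|M| + 1); first by rewrite addr_ge0.
  move=> s spi; apply: HM => /=; exists s => //.
  by rewrite /= in_itv/= -ler_norml.
have pi2 : 2 <= pi :> R by exact: pi_ge2.
(* [1 + y] is the weight, [p] its excess over [1] on [|s| <= d]. *)
pose y (s : R) := cos s - cos d.
pose p (s : R) := Num.max (y s) 0.
have cy : continuous y.
  by apply: continuous_add; [exact: continuous_cos|exact: cst_continuous].
have cp : continuous p.
  move=> s; apply: (@continuous_max _ _ y (fun=> 0) s);
    [exact: cy|exact: cst_continuous].
have yd : 0 < cos (d / 2) - cos d.
  rewrite subr_gt0 ltr_cos ?in_itv/=; lra.
pose m := itg (- pi) pi p.
have m0 : 0 < m.
  apply: (@lt_le_trans _ _ (itg (- (d / 2)) (d / 2) p)); last first.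
    apply: le_itg_sub => //; [lra|lra|].
    by move=> s; rewrite /p le_max lexx orbT.
  apply: (@lt_le_trans _ _ (itg (- (d / 2)) (d / 2) (fun=> cos (d / 2) - cos d))).
    rewrite itg_cst; last lra.
    by apply: mulr_gt0 => //; lra.
  apply: le_itg => //; first exact: cst_continuous.
  move=> s sd; rewrite /p le_max; apply/orP; left; rewrite /y lerD2r.
  have d2 : `|d / 2| = d / 2 by rewrite ger0_norm//; lra.
  by apply: cos_le_norm; rewrite d2; [rewrite ler_norml|lra].
(* The power is chosen so that the linear lower bound beats the part of the
   integral where the sign of [f] is unknown. *)
have [n Hn] : exists n : nat, M * (pi - - pi) < n%:R * (f x / 2 * m).
  have fm : 0 < f x / 2 * m by rewrite mulr_gt0// divr_gt0.
  exists (Num.bound (M * (pi - - pi) / (f x / 2 * m))).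
  rewrite -ltr_pdivrMr//; apply: archi_boundP.
  by apply: divr_ge0 (ltW fm); apply: mulr_ge0 => //; lra.
have := favg0_pow (1 - cos d) cf f0 n 0.
pose G s := f (x + s *: e j) * (cos (0%:R * s) * (cos s + (1 - cos d)) ^+ n).
have cG : continuous G.
  apply: (@continuous_integrand R
    (fun s => cos (0%:R * s) * (cos s + (1 - cos d)) ^+ n)) => //.
  apply: continuous_mul.
    by apply: (@is_derive_continuous _ _ (fun s => - sin (0%:R * s) * 0%:R)) => s;
      exact: is_derive_cosZ.
  exact: continuous_cosX.
rewrite -/(itg (- pi) pi G) => G0.
have c0 : continuous (fun s => n%:R * (f x / 2) * p s).
  by apply: continuous_mul => //; exact: cst_continuous.
have cL : continuous (fun s => - M + n%:R * (f x / 2) * p s).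
  by apply: continuous_add => //; exact: cst_continuous.
have : itg (- pi) pi (fun s => - M + n%:R * (f x / 2) * p s) <= itg (- pi) pi G.
  apply: le_itg => // s; rewrite -ler_norml => spi.
  have Gs : G s = g s * (1 + y s) ^+ n.
    rewrite /G mul0r cos0 mul1r /y; congr (_ * _ ^+ _); ring.
  rewrite Gs; case: (leP `|s| d) => sd.
    have ys : 0 <= y s.
      rewrite subr_ge0; apply: cos_le_norm; rewrite (ger0_norm (ltW d0))//; lra.
    have -> : p s = y s by apply/max_idPl.
    have gs := gd _ sd.
    have B := bernoulli_ineq n (le_trans (lerN10 R) ys).
    have P : 0 <= (1 + y s) ^+ n by rewrite exprn_ge0//; lra.
    have h1 : f x / 2 * (1 + n%:R * y s) <= g s * (1 + y s) ^+ n.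
      apply: le_trans (ler_wpM2l _ B) _; first lra.
      exact: ler_wpM2r.
    apply: le_trans h1; lra.
  have ys : y s <= 0.
    rewrite subr_le0; apply: cos_le_norm => //; rewrite (ger0_norm (ltW d0));
      exact: ltW.
  have -> : p s = 0 by apply/max_idPr.
  rewrite mulr0 addr0.
  have T1 : `|1 + y s| <= 1.
    rewrite ler_norml; have := cos_geN1 s; have := cos_le1 d; rewrite /y in ys *; lra.
  have T2 : `|(1 + y s) ^+ n| <= 1 by rewrite normrX exprn_ile1.
  have : `|g s * (1 + y s) ^+ n| <= M.
    rewrite normrM -[M]mulr1; apply: ler_pM => //; exact: gM.
  by rewrite ler_norml => /andP[].
rewrite G0 itgD ?itg_cst ?itgZ//; [|exact/ltW/Npi_lt_pi|exact: cst_continuous].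
rewrite -/m; lra.
Qed.

End Uniq.

(** * Orthogonality of the Fourier averages *)

Section Decomp.
Variable R : realType.
Local Notation V := 'rV[R]_3.
Local Notation e := (@evec R).
Implicit Types (f : V -> R) (w : R -> R) (x v : V) (i j : 'I_3) (k l : nat).

(** As functions on the line, the cosine and sine averages satisfy the linear system
    [h' = k m], [m' = - k h], whose solutions are rotations. *)
Lemma favg_line k j f x (t : R) : Ck 1 f -> periodic_2pi f ->
  favg k 1 0 j f (x + t *: e j) =
  cos (k%:R * t) * favg k 1 0 j f x + sin (k%:R * t) * favg k 0 1 j f x.
Proof.
move=> kf pf.
pose h t := favg k 1 0 j f (x + t *: e j); pose m t := favg k 0 1 j f (x + t *: e j).
have Dh (s : R) : is_derive s 1 h (k%:R * m s).
  apply/is_derive_line; rewrite /m -favgZw; last exact: Ck_continuous kf.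
  have := Ck_is_derive (k := 0) j (x + s *: e j) (Ck_favg k 1 0 j kf).
  by rewrite partial_favg// favg_partial// !mulr0 mulr1 oppr0.
have Dm (s : R) : is_derive s 1 m (- k%:R * h s).
  apply/is_derive_line; rewrite /h -favgZw; last exact: Ck_continuous kf.
  have := Ck_is_derive (k := 0) j (x + s *: e j) (Ck_favg k 0 1 j kf).
  by rewrite partial_favg// favg_partial// !mulr0 !mulr1.
(* The solution rotated backwards is constant. *)
have D1 (s : R) : is_derive s 1
    (fun s => cos (k%:R * s) * h s + -1 * (sin (k%:R * s) * m s)) 0.
  have -> : 0 = (cos (k%:R * s) * (k%:R * m s) + h s * (- sin (k%:R * s) * k%:R)) +
    -1 * (sin (k%:R * s) * (- k%:R * h s) + m s * (cos (k%:R * s) * k%:R)) by ring.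
  apply: is_derive_addr; last apply: is_derive_cmul; apply: is_derive_mulr => //.
    exact: is_derive_cosZ.
  exact: is_derive_sinZ.
have D2 (s : R) : is_derive s 1
    (fun s => sin (k%:R * s) * h s + cos (k%:R * s) * m s) 0.
  have -> : 0 = (sin (k%:R * s) * (k%:R * m s) + h s * (cos (k%:R * s) * k%:R)) +
    (cos (k%:R * s) * (- k%:R * h s) + m s * (- sin (k%:R * s) * k%:R)) by ring.
  apply: is_derive_addr; apply: is_derive_mulr => //.
    exact: is_derive_sinZ.
  exact: is_derive_cosZ.
have := is_derive_0_is_cst t 0 D1; have := is_derive_0_is_cst t 0 D2.
rewrite !mulr0 cos0 sin0 {2 4}/h {2 4}/m scale0r addr0 => E2 E1.
have CS := cos2Dsin2 (k%:R * t).
rewrite -/(h t).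
rewrite (_ : favg k 1 0 j f x = cos (k%:R * t) * h t - sin (k%:R * t) * m t);
  last by lra.
rewrite (_ : favg k 0 1 j f x = sin (k%:R * t) * h t + cos (k%:R * t) * m t);
  last by lra.
move: (h t) (m t) => H M.
transitivity ((cos (k%:R * t) ^+ 2 + sin (k%:R * t) ^+ 2) * H); last by ring.
by rewrite CS mul1r.
Qed.

(** The operator [d_j d_j] is symmetric for the average and has the distinct
    eigenvalues [- k^2] and [- l^2]. *)
Lemma favg_favg_neq k l j f x : Ck 2 f -> periodic_2pi f -> k != l ->
  favg l 1 0 j (favg k 1 0 j f) x = 0.
Proof.
move=> kf pf kl; have k1 := CkS kf.
have := favg_partial2 l 1 0 j x (Ck_favg k 1 0 j kf) (periodic_favg k 1 0 j pf).
rewrite partial2_favg// favgZ; last first.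
  by apply: (@Ck_continuous _ 1); exact: Ck_favg.
move=> /eqP; rewrite -subr_eq0 -mulrBl mulf_eq0 => /orP[|/eqP//].
rewrite opprK addrC subr_eq0 eqrXn2 ?ler0n// eqr_nat => /eqP lk.
by rewrite lk eqxx in kl.
Qed.

(** The integral of [cos (k s) ^+ 2] over a period. *)
Definition cosnorm k : R := if k == 0%N then 2 * pi else pi.

Lemma favg_favg_eq k j f x : Ck 1 f -> periodic_2pi f ->
  favg k 1 0 j (favg k 1 0 j f) x = cosnorm k * favg k 1 0 j f x.
Proof.
move=> kf pf; set A := favg k 1 0 j f x; set B := favg k 0 1 j f x.
have cc (g : R -> R) : continuous g -> forall c : R, continuous (fun s => c * g s).
  by move=> cg c; apply: continuous_mul => //; exact: cst_continuous.
have cosc : continuous (fun s : R => cos (k%:R * s)).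
  by apply: (@is_derive_continuous _ _ (fun s => - sin (k%:R * s) * k%:R)) => s;
    exact: is_derive_cosZ.
have sinc : continuous (fun s : R => sin (k%:R * s)).
  by apply: (@is_derive_continuous _ _ (fun s => cos (k%:R * s) * k%:R)) => s;
    exact: is_derive_sinZ.
have E : favg k 1 0 j (favg k 1 0 j f) x = itg (- pi) pi (fun s =>
    A * (cos (k%:R * s) * cos (k%:R * s)) + B * (sin (k%:R * s) * cos (k%:R * s))).
  congr itg; apply/funext => s; rewrite favg_line// /trig -/A -/B; ring.
have cCC := continuous_mul cosc cosc; have cSC := continuous_mul sinc cosc.
rewrite E itgD ?itgZ//; [|exact: cc|exact: cc].
rewrite /cosnorm; case: eqP => [k0|/eqP k0].
  have -> : (fun s : R => cos (k%:R * s) * cos (k%:R * s)) = fun=> 1.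
    by apply/funext => s; rewrite k0 mul0r cos0 mulr1.
  have -> : (fun s : R => sin (k%:R * s) * cos (k%:R * s)) = fun=> 0.
    by apply/funext => s; rewrite k0 mul0r sin0 mul0r.
  by rewrite !itg_cst ?(ltW (Npi_lt_pi _))//; ring.
have kn0 : k%:R != 0 :> R by rewrite pnatr_eq0.
have DS (s : R) : is_derive s 1
    (fun s => (2 * k%:R)^-1 * (sin (k%:R * s) * sin (k%:R * s)))
    (sin (k%:R * s) * cos (k%:R * s)).
  have -> : sin (k%:R * s) * cos (k%:R * s) = (2 * k%:R)^-1 *
    (sin (k%:R * s) * (cos (k%:R * s) * k%:R) +
     sin (k%:R * s) * (cos (k%:R * s) * k%:R)) by field.
  by apply: is_derive_cmul; apply: is_derive_mulr; exact: is_derive_sinZ.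
have DC (s : R) : is_derive s 1
    (fun s => 2^-1 * s + (2 * k%:R)^-1 * (sin (k%:R * s) * cos (k%:R * s)))
    (cos (k%:R * s) * cos (k%:R * s)).
  have -> : cos (k%:R * s) * cos (k%:R * s) = 2^-1 + (2 * k%:R)^-1 *
    (sin (k%:R * s) * (- sin (k%:R * s) * k%:R) +
     cos (k%:R * s) * (cos (k%:R * s) * k%:R)).
    have := cos2Dsin2 (k%:R * s); set C := cos _; set S := sin _ => CS.
    by rewrite (_ : 2^-1 = (C ^+ 2 + S ^+ 2) / 2); [field|rewrite CS mul1r].
  apply: is_derive_addr; first exact: is_derive_linear.
  apply: is_derive_cmul; apply: is_derive_mulr; first exact: is_derive_sinZ.
  exact: is_derive_cosZ.
rewrite (itg_derive (Npi_lt_pi _) cCC DC) (itg_derive (Npi_lt_pi _) cSC DS).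
by rewrite !mulrN sinN !sin_natpi; field.
Qed.

Lemma cosnorm_neq0 k : cosnorm k != 0.
Proof.
by rewrite /cosnorm; have := pi_gt0 R; case: ifP => _ H; rewrite gt_eqF//; lra.
Qed.

End Decomp.

(** * Smoothness of periodic eigenfunctions *)

Section Regularity.
Variable R : realType.
Local Notation V := 'rV[R]_3.
Implicit Types (f : V -> R) (w : R -> R) (x v : V) (i j : 'I_3) (k l : nat).

Lemma ord3_ind (P : 'I_3 -> Prop) : P c1 -> P c2 -> P c3 -> forall j, P j.
Proof.
move=> P1 P2 P3 [[|[|[|//]]] h].
- by rewrite (_ : Ordinal h = c1)//; exact: val_inj.
- by rewrite (_ : Ordinal h = c2)//; exact: val_inj.
- by rewrite (_ : Ordinal h = c3)//; exact: val_inj.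
Qed.

Lemma sum3E (F : 'I_3 -> R) : \sum_(j < 3) F j = F c1 + F c2 + F c3.
Proof.
rewrite !big_ord_recr big_ord0 /= add0r.
by congr (F _ + F _ + F _); exact: val_inj.
Qed.

Definition helmholtz (mu : R) f := forall x, laplacian f x = - mu * f x.

Lemma partial_favg2 k a b i j f : Ck 2 f ->
  partial i (partial i (favg k a b j f)) = favg k a b j (partial i (partial i f)).
Proof.
move=> kf; rewrite (partial_favg _ _ _ _ _ (CkS kf)).
by rewrite (partial_favg _ _ _ _ _ (Ck_partial i kf)).
Qed.

Lemma favg_helmholtz mu k a b j f : Ck 2 f -> helmholtz mu f ->
  helmholtz mu (favg k a b j f).
Proof.
move=> kf fmu x.
have cp i : continuous (partial i (partial i f)).
  by have := Ck_partial i (Ck_partial i kf).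
rewrite -[RHS]/((fun y => - mu * favg k a b j f y) x) -favgZ;
  last exact: Ck_continuous kf.
under [in RHS]eq_fun do rewrite -fmu /laplacian sum3E.
rewrite !favgD//; last by apply: continuous_add.
rewrite /laplacian sum3E.
by rewrite (partial_favg2 _ _ _ c1 _ kf) (partial_favg2 _ _ _ c2 _ kf)
  (partial_favg2 _ _ _ c3 _ kf).
Qed.

Lemma favg_partial2_eq c k a b i j f : Ck 2 f ->
  partial i (partial i f) = (fun x => c * f x) ->
  partial i (partial i (favg k a b j f)) = (fun x => c * favg k a b j f x).
Proof.
by move=> kf fc; rewrite partial_favg2// fc favgZ//; exact: Ck_continuous kf.
Qed.

(** When every second derivative acts on [f] as a nonpositive scalar, so does the
    Laplacian, and a direction with scalar [- c] makes the total less than [- mu]. *)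
Lemma helmholtz_separated_eq0 (mu c : R) (kappa : 'I_3 -> R) j f :
  helmholtz mu f -> mu < c -> (forall i, 0 <= kappa i) ->
  (forall i, partial i (partial i f) = (fun x => - kappa i * f x)) ->
  partial j (partial j f) = (fun x => - c * f x) -> forall x, f x = 0.
Proof.
move=> fmu muc k0 fk fc x.
have := fmu x; rewrite /laplacian (bigD1 j)//= fc.
under eq_bigr do rewrite fk.
rewrite -mulr_suml sumrN => /eqP.
rewrite -subr_eq0 -!mulrDl -mulrBl mulf_eq0 => /orP[|/eqP//].
have : 0 <= \sum_(i < 3 | i != j) kappa i by apply: sumr_ge0.
by move=> S0 /eqP; lra.
Qed.

(** By uniqueness of Fourier coefficients in each direction it is enough that all
    triple averages of [favg k 1 0 j f] vanish, and these have separated variables. *)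
Lemma favg_eigen_eq0 mu k j f x : Ck 2 f -> periodic_2pi f -> helmholtz mu f ->
  mu < k%:R ^+ 2 -> favg k 1 0 j f x = 0.
Proof.
move=> kf pf fmu muk; set g := favg k 1 0 j f.
have kg : Ck 2 g by exact: Ck_favg.
have pg : periodic_2pi g by exact: periodic_favg.
have gmu : helmholtz mu g by exact: favg_helmholtz.
have gk : partial j (partial j g) = (fun y => - k%:R ^+ 2 * g y).
  by apply: partial2_favg => //; exact: CkS.
apply: (favg_eq0 (j := c1)); first exact: Ck_continuous kg.
move=> k1; move: x; set g1 := favg k1 1 0 c1 g => x.
have kg1 : Ck 2 g1 by exact: Ck_favg.
have pg1 : periodic_2pi g1 by exact: periodic_favg.
apply: (favg_eq0 (j := c2)); first exact: Ck_continuous kg1.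
move=> k2; move: x; set g2 := favg k2 1 0 c2 g1 => x.
have kg2 : Ck 2 g2 by exact: Ck_favg.
have pg2 : periodic_2pi g2 by exact: periodic_favg.
apply: (favg_eq0 (j := c3)); first exact: Ck_continuous kg2.
move=> k3; move: x; set g3 := favg k3 1 0 c3 g2 => x.
have E1 : partial c1 (partial c1 g1) = (fun y => - k1%:R ^+ 2 * g1 y).
  by apply: partial2_favg => //; exact: CkS.
have E2 : partial c2 (partial c2 g2) = (fun y => - k2%:R ^+ 2 * g2 y).
  by apply: partial2_favg => //; exact: CkS.
have E3 : partial c3 (partial c3 g3) = (fun y => - k3%:R ^+ 2 * g3 y).
  by apply: partial2_favg => //; exact: CkS.
apply: (@helmholtz_separated_eq0 mu (k%:R ^+ 2)
  (fun i => nth 0 [:: k1%:R ^+ 2; k2%:R ^+ 2; k3%:R ^+ 2] i) j) => //.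
- by do 3 apply: favg_helmholtz => //.
- by apply: ord3_ind; exact: sqr_ge0.
- apply: ord3_ind => //=; last exact: favg_partial2_eq.
  by do 2 apply: favg_partial2_eq => //.
- by do 3 apply: favg_partial2_eq => //.
Qed.

Lemma favg_sum n k a b j (F : 'I_n -> V -> R) x : (forall m, continuous (F m)) ->
  favg k a b j (fun y => \sum_(m < n) F m y) x = \sum_(m < n) favg k a b j (F m) x.
Proof.
elim: n F => [|n IH] F cF.
  rewrite big_ord0 -[RHS](mul0r (favg k a b j (fun=> 0) x)).
  rewrite -[RHS]/((fun y => 0 * favg k a b j (fun=> 0) y) x) -favgZ;
    last exact: cst_continuous.
  by congr (favg _ _ _ _ _ x); apply/funext => y; rewrite big_ord0 mul0r.
under eq_fun do rewrite big_ord_recr.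
have csum p (G : 'I_p -> V -> R) : (forall m, continuous (G m)) ->
  continuous (fun y => \sum_(m < p) G m y).
  by move=> cG; exact: (@Ck_sum _ 0).
rewrite favgD//=; last exact: csum.
by rewrite IH// big_ord_recr.
Qed.

(** The bound [K] on the frequencies depends on [mu] only: it serves for all
    directions and for the successive averages of an eigenfunction. *)
Lemma helmholtz_fourier mu : exists K : nat, forall f j, Ck 2 f -> periodic_2pi f ->
  helmholtz mu f ->
  f = (fun x => \sum_(k < K) (cosnorm R k)^-1 * favg k 1 0 j f x).
Proof.
pose K := (Num.bound `|mu|).+1; exists K => f j kf pf fmu.
have hK l : (K <= l)%N -> mu < l%:R ^+ 2.
  move=> Kl; apply: (le_lt_trans (ler_norm mu)).
  apply: (lt_le_trans (archi_boundP (normr_ge0 mu))).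
  rewrite -natrX ler_nat; apply: (leq_trans (leqnSn _)); apply: (leq_trans Kl).
  by rewrite -[X in (X <= _)%N]expn1 leq_pexp2l//; apply: leq_trans Kl.
have cF k : continuous (favg k 1 0 j f).
  by apply: (@Ck_continuous _ 2); exact: Ck_favg.
have cG (k : nat) (c : R) : continuous (fun y => c * favg k 1 0 j f y).
  by apply: (@CkZ _ 0); exact: cF.
pose S y := \sum_(k < K) (cosnorm R k)^-1 * favg k 1 0 j f y.
have cS : continuous S by apply: (@Ck_sum _ 0) => k; exact: cG.
have cN : continuous (fun y => -1 * S y) by exact: (@CkZ _ 0).
suff H x : f x + -1 * S x = 0.
  by apply/funext => x; have := H x; rewrite -/(S x); lra.
apply: (favg_eq0 (f := fun y => f y + -1 * S y) (j := j)).
  by apply: continuous_add => //; exact: Ck_continuous kf.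
move=> l; rewrite favgD//; last exact: Ck_continuous kf.
rewrite favgZ//= favg_sum//.
rewrite (eq_bigr (fun k : 'I_K =>
  (cosnorm R k)^-1 * favg l 1 0 j (favg k 1 0 j f) x)); last first.
  by move=> k _; rewrite favgZ.
have ne k : k != l -> (cosnorm R k)^-1 * favg l 1 0 j (favg k 1 0 j f) x = 0.
  by move=> kl; rewrite favg_favg_neq ?mulr0.
case: (ltnP l K) => lK.
  rewrite (bigD1 (Ordinal lK))//= big1 ?addr0; last first.
    by move=> k; rewrite -val_eqE /=; exact: ne.
  rewrite favg_favg_eq//; last exact: CkS.
  by rewrite mulKf ?cosnorm_neq0//; ring.
rewrite big1; last by move=> k _; apply: ne; rewrite neq_ltn (leq_trans _ lK).
by rewrite mulr0 addr0; apply: favg_eigen_eq0 fmu (hK _ lK).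
Qed.

(** Each partial derivative of a triple average is a triple average with other
    weights, which gives all orders of regularity at once. *)
Lemma Ck_favg3 n k1 a1 b1 k2 a2 b2 k3 a3 b3 f : Ck 1 f -> periodic_2pi f ->
  Ck n (favg k1 a1 b1 c1 (favg k2 a2 b2 c2 (favg k3 a3 b3 c3 f))).
Proof.
move=> kf pf; elim: n a1 b1 a2 b2 a3 b3 => [|n IH] a1 b1 a2 b2 a3 b3.
  by apply: (@Ck_continuous _ 1); do 3 apply: Ck_favg.
have kp k (a b : R) j (g : V -> R) : Ck 1 g /\ periodic_2pi g ->
  Ck 1 (favg k a b j g) /\ periodic_2pi (favg k a b j g).
  by move=> [kg pg]; split; [exact: Ck_favg|exact: periodic_favg].
have H3 := kp k3 a3 b3 c3 f (conj kf pf).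
have H2 := kp k2 a2 b2 c2 _ H3; have H1 := kp k1 a1 b1 c1 _ H2.
split; first exact: (Ck_continuous H1.1).
move=> j; split=> [y|]; first exact: Ck_derivable H1.1.
move: j; apply: ord3_ind.
- rewrite (partial_favg k1 a1 b1 c1 c1 H2.1) (favg_partial k1 a1 b1 c1 H2.1 H2.2).
  exact: IH.
- rewrite (partial_favg k1 a1 b1 c1 c2 H2.1) (partial_favg k2 a2 b2 c2 c2 H3.1).
  rewrite (favg_partial k2 a2 b2 c2 H3.1 H3.2); exact: IH.
- rewrite (partial_favg k1 a1 b1 c1 c3 H2.1) (partial_favg k2 a2 b2 c2 c3 H3.1).
  rewrite (partial_favg k3 a3 b3 c3 c3 kf) (favg_partial k3 a3 b3 c3 kf pf);
    exact: IH.
Qed.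

Definition smooth f := forall n, Ck n f.

(** Elliptic regularity on the torus: a C^2 eigenfunction is a trigonometric
    polynomial. *)
Theorem eigenfunction_smooth lambda f : eigenfunction lambda f -> smooth f.
Proof.
move=> [kf _ fl pf] n.
have fmu : helmholtz (lambda ^+ 2) f by move=> x; rewrite mulNr -fl opprK.
have [K HK] := helmholtz_fourier (lambda ^+ 2).
rewrite (HK f c3)//; apply: Ck_sum => k3; apply: CkZ.
have kf3 := Ck_favg k3 1 0 c3 kf; have pf3 := periodic_favg k3 1 0 c3 pf.
have fmu3 : helmholtz (lambda ^+ 2) (favg k3 1 0 c3 f) by exact: favg_helmholtz.
rewrite (HK (favg k3 1 0 c3 f) c2)//; apply: Ck_sum => k2; apply: CkZ.
rewrite (HK (favg k2 1 0 c2 (favg k3 1 0 c3 f)) c1).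
- by apply: Ck_sum => k1; apply: CkZ; apply: Ck_favg3 => //; exact: CkS.
- exact: Ck_favg.
- exact: periodic_favg.
- exact: favg_helmholtz.
Qed.

End Regularity.

(** * Polynomials and linear forms on their coefficients *)

Section Poly.
Variable R : realType.
Local Notation poly3 := (mpoly.mpoly 3 R).
Implicit Types (p q : poly3) (D : multinom 3 -> R).

(** With [D m] the derivative of multi-order [m] of [f] at [x], this linear form in
    [p] is the value of [p(nabla) f] at [x]; through it, polynomial identities
    become identities between operators. *)
Definition pairing D p : R := \sum_(m <- msupp p) mcoeff m p * D m.

Lemma pairingE D p n : (mmeasure mdeg p <= n)%N ->
  pairing D p = \sum_(m : bmultinom 3 n) mcoeff m p * D m.
Proof.
move=> pn; pose I : subFinType _ := bmultinom 3 n.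
rewrite /pairing (big_mksub I) ?msupp_uniq //=; first last.
  by move=> m /msize_mdeg_lt /leq_trans; apply.
by rewrite big_rmcond //= => m /memN_msupp_eq0 ->; rewrite mul0r.
Qed.

Lemma pairingD D p q : pairing D (p + q) = pairing D p + pairing D q.
Proof.
pose n := maxn (maxn (mmeasure mdeg p) (mmeasure mdeg q)) (mmeasure mdeg (p + q)).
rewrite !(@pairingE _ _ n) ?/n ?leq_max ?leqnn ?orbT//.
by rewrite -big_split; apply: eq_bigr => m _; rewrite mcoeffD mulrDl.
Qed.

Lemma pairing0 D : pairing D 0 = 0.
Proof. by apply: (addrI (pairing D 0)); rewrite -pairingD !addr0. Qed.

Lemma pairing_sum D n (F : 'I_n -> poly3) :
  pairing D (\sum_(i < n) F i) = \sum_(i < n) pairing D (F i).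
Proof. by apply: (big_morph (pairing D)); [exact: pairingD|exact: pairing0]. Qed.

Lemma pairingZX D c m : pairing D (c *: mpolyX R m) = c * D m.
Proof.
have [->|c0] := eqVneq c 0; first by rewrite scale0r pairing0 mul0r.
by rewrite /pairing msuppMCX// big_seq1 mcoeffZ mcoeffX eqxx mulr1.
Qed.

Lemma pairing_mulX D (j : 'I_3) p :
  pairing D (mpolyX R (mnm1 j) * p) = pairing (fun m => D (mnm_add (mnm1 j) m)) p.
Proof.
elim/mpolyind: p => [|c m p _ _ IH]; first by rewrite mulr0 !pairing0.
by rewrite mulrDr !pairingD IH -scalerAr -mpolyXD !pairingZX.
Qed.

Lemma poly_eq0_horner (q : {poly R}) : (forall t, q.[t] = 0) -> q = 0.
Proof.
move=> q0; apply/eqP; apply: contraT => qn0.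
have := @max_poly_roots _ q [seq n%:R | n <- iota 0 (size q)] qn0.
rewrite size_map size_iota ltnn; apply.
  by apply/allP => t _; apply/rootP.
by rewrite map_inj_uniq ?iota_uniq// => a b /eqP; rewrite eqr_nat => /eqP.
Qed.

Lemma digits_inj d a a' b b' : (a < d)%N -> (a' < d)%N ->
  (a + d * b = a' + d * b')%N -> a = a' /\ b = b'.
Proof.
move=> ad a'd; rewrite !(mulnC d) ![(_ + _ * d)%N]addnC => E.
have d0 : (0 < d)%N by exact: leq_ltn_trans ad.
have := congr1 (modn^~ d) E; have := congr1 (divn^~ d) E => /=.
by rewrite !divnMDl// !modnMDl !divn_small// !modn_small// !addn0.
Qed.

(** Kronecker substitution: [X_i := t^(d^i)] with [d] larger than all exponents
    sends distinct monomials of [p] to distinct powers of [t], which reduces the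
    claim to univariate polynomials over an infinite field. *)
Lemma mpoly_eq0_meval p : (forall v : 'I_3 -> R, meval v p = 0) -> p = 0.
Proof.
move=> p0; pose d := mmeasure mdeg p.
pose enc (m : multinom 3) := (m c1 + d * (m c2 + d * m c3))%N.
have enc_inj m m' : m \in msupp p -> m' \in msupp p -> enc m = enc m' -> m = m'.
  have lt_d n i : n \in msupp p -> (n i < d)%N.
    move=> /msize_mdeg_lt; apply: leq_ltn_trans.
    by rewrite mdegE (bigD1 i)//= leq_addr.
  move=> pm pm' /digits_inj[]; [exact: lt_d|exact: lt_d|].
  move=> e1 /digits_inj[]; [exact: lt_d|exact: lt_d|].
  move=> e2 e3; apply/mnmP; exact: ord3_ind.
pose q : {poly R} := \sum_(m <- msupp p) mcoeff m p *: 'X^(enc m).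
have q0 : q = 0.
  apply: poly_eq0_horner => t; rewrite -[RHS](p0 (fun i => t ^+ (d ^ i))) mevalE.
  rewrite /q horner_sum; apply: eq_bigr => m _.
  rewrite hornerZ hornerXn; congr (_ * _).
  rewrite !big_ord_recr big_ord0 /= mul1r -!exprM -!exprD; congr (_ ^+ _).
  rewrite /enc expn0 expn1 mul1n (_ : widen_ord _ _ = c1); last exact: val_inj.
  rewrite (_ : widen_ord _ _ = c2); last exact: val_inj.
  rewrite (_ : ord_max = c3); last exact: val_inj.
  by rewrite mulnDr mulnA addnA.
apply/mpolyP => m; rewrite mcoeff0; apply/eqP; rewrite mcoeff_eq0; apply/negP => pm.
have := congr1 (fun r : {poly R} => r`_(enc m)) q0.
rewrite coef0 /q coef_sum (bigD1_seq m) ?msupp_uniq//=.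
rewrite coefZ coefXn eqxx mulr1 big_seq_cond big1 ?addr0.
  by apply/eqP; rewrite -mcoeff_msupp.
move=> m' /andP[pm' mm']; rewrite coefZ coefXn.
case: eqP => [E|_]; last by rewrite mulr0.
by rewrite (enc_inj _ _ pm pm' E) eqxx in mm'.
Qed.

Lemma perpendicular_mpoly (A : 'I_3 -> poly3) : perpendicular A ->
  \sum_(j < 3) mpolyX R (mnm1 j) * A j = 0.
Proof.
move=> hA; apply: mpoly_eq0_meval => v.
rewrite -[RHS](hA (\row_i v i)) raddf_sum; apply: eq_bigr => j _.
rewrite /= mevalM mevalXU mxE; congr (_ * _).
by apply: meval_eq => i; rewrite mxE.
Qed.

End Poly.

(** * Constant-coefficient operators on smooth functions *)

(** Ring and linear arithmetic tactics compare atoms up to conversion, and would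
    unfold iterated derivatives down to their limits; naming the values of the
    derivatives keeps them opaque. *)
Ltac generalize_partials :=
  repeat match goal with
  | |- context [partial ?j ?f ?x] => generalize (partial j f x); intro
  end.

Section Fields.
Variable R : realType.
Local Notation V := 'rV[R]_3.
Local Notation poly3 := (mpoly.mpoly 3 R).
Implicit Types (f g : V -> R) (x v : V) (i j : 'I_3) (p : poly3).
Implicit Types (h u : 'I_3 -> V -> R).

Lemma smooth_partial f j : smooth f -> smooth (partial j f).
Proof. by move=> sf n; exact: Ck_partial (sf n.+1). Qed.

Lemma smoothD f g : smooth f -> smooth g -> smooth (fun x => f x + g x).
Proof. by move=> sf sg n; exact: CkD. Qed.

Lemma smoothZ c f : smooth f -> smooth (fun x => c * f x).
Proof. by move=> sf n; exact: CkZ. Qed.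

Lemma smooth_iter n j f : smooth f -> smooth (iter n (partial j) f).
Proof. by move=> sf; elim: n => //= n; exact: smooth_partial. Qed.

Lemma partial_iter n i j f : smooth f ->
  partial j (iter n (partial i) f) = iter n (partial i) (partial j f).
Proof.
move=> sf; elim: n => //= n <-.
by apply: partial_comm; exact: smooth_iter.
Qed.

Lemma smooth_dmonomial m f : smooth f -> smooth (dmonomial m f).
Proof. by move=> sf; do 3 apply: smooth_iter. Qed.

Lemma partial_dmonomial m j f : smooth f ->
  partial j (dmonomial m f) = dmonomial m (partial j f).
Proof.
move=> sf; rewrite /dmonomial partial_iter; last by do 2 apply: smooth_iter.
rewrite partial_iter; last exact: smooth_iter.
by rewrite partial_iter.
Qed.

Lemma dmonomialS m j f : smooth f ->
  dmonomial (mnm_add (mnm1 j) m) f = dmonomial m (partial j f).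
Proof.
move=> sf; rewrite -partial_dmonomial// /dmonomial.
(* In the direction applied last both sides are convertible; in the other two the
   derivative has to be moved inside. *)
move: j; apply: ord3_ind; rewrite !mnmDE !mnm1E /= ?add0n ?add1n //=.
- by rewrite [RHS]partial_iter//; do 2 apply: smooth_iter.
- rewrite [RHS]partial_iter; last by do 2 apply: smooth_iter.
  by rewrite [in RHS]partial_iter//; apply: smooth_iter.
Qed.

Lemma iter_partialD n j f g : smooth f -> smooth g ->
  iter n (partial j) (fun x => f x + g x) =
  (fun x => iter n (partial j) f x + iter n (partial j) g x).
Proof.
move=> sf sg; elim: n => //= n ->; apply: partialD; exact: smooth_iter.
Qed.

Lemma iter_partialZ n j c f : smooth f ->
  iter n (partial j) (fun x => c * f x) = (fun x => c * iter n (partial j) f x).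
Proof. by move=> sf; elim: n => //= n ->; apply: partialZ; exact: smooth_iter. Qed.

Lemma smooth_polyop p f : smooth f -> smooth (polyop p f).
Proof. by move=> sf n; apply: Ck_sum => m; apply: CkZ; exact: smooth_dmonomial. Qed.

Lemma partial_polyop p j f : smooth f ->
  partial j (polyop p f) = polyop p (partial j f).
Proof.
move=> sf; rewrite /polyop partial_sum; last first.
  by move=> m; apply: CkZ; exact: smooth_dmonomial.
apply/funext => x; apply: eq_bigr => m _.
by rewrite partialZ ?partial_dmonomial//; exact: smooth_dmonomial.
Qed.

Lemma polyopD p f g : smooth f -> smooth g ->
  polyop p (fun x => f x + g x) = (fun x => polyop p f x + polyop p g x).
Proof.
move=> sf sg; apply/funext => x; rewrite /polyop -big_split; apply: eq_bigr => m _ /=.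
rewrite -mulrDr /dmonomial iter_partialD//.
rewrite iter_partialD; [|exact: smooth_iter|exact: smooth_iter].
by rewrite iter_partialD//; do 2 apply: smooth_iter.
Qed.

Lemma polyopZ p c f : smooth f ->
  polyop p (fun x => c * f x) = (fun x => c * polyop p f x).
Proof.
move=> sf; apply/funext => x; rewrite /polyop mulr_sumr; apply: eq_bigr => m _.
rewrite mulrCA /dmonomial iter_partialZ// iter_partialZ; last exact: smooth_iter.
by rewrite iter_partialZ//; do 2 apply: smooth_iter.
Qed.

Lemma helmholtz_polyop mu p f : smooth f -> helmholtz mu f ->
  helmholtz mu (polyop p f).
Proof.
move=> sf fmu x; rewrite /laplacian sum3E.
have s2 j : smooth (partial j (partial j f)) by do 2 apply: smooth_partial.
have p2 j : partial j (partial j (polyop p f)) = polyop p (partial j (partial j f)).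
  by rewrite partial_polyop// partial_polyop//; exact: smooth_partial.
rewrite !p2 -[RHS]/((fun x => - mu * polyop p f x) x) -polyopZ//.
rewrite (_ : (fun x => - mu * f x) = (fun x => partial c1 (partial c1 f) x +
  partial c2 (partial c2 f) x + partial c3 (partial c3 f) x)); last first.
  by apply/funext => y; rewrite -fmu /laplacian sum3E.
by rewrite !polyopD//; exact: smoothD.
Qed.

Lemma periodic_iter_partial n j f : periodic_2pi f ->
  periodic_2pi (iter n (partial j) f).
Proof. by move=> pf; elim: n => //= n; exact: periodic_partial. Qed.

Lemma periodic_polyop p f : periodic_2pi f -> periodic_2pi (polyop p f).
Proof.
move=> pf x j; apply: eq_bigr => m _; congr (_ * _).
have : periodic_2pi (dmonomial m f) by do 3 apply: periodic_iter_partial.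
exact.
Qed.

(** The divergence of [A(nabla) f] is the operator of symbol [x . A(x) = 0]. *)
Lemma divergence_free_polyop (A : 'I_3 -> poly3) f x : perpendicular A -> smooth f ->
  \sum_(j < 3) partial j (polyop (A j) f) x = 0.
Proof.
move=> /perpendicular_mpoly hA sf.
rewrite -[RHS](pairing0 (fun m => dmonomial m f x)) -hA pairing_sum.
apply: eq_bigr => j _; rewrite partial_polyop// pairing_mulX.
by apply: eq_bigr => m _; rewrite dmonomialS.
Qed.

(** * Curl and Beltrami fields *)

Definition curl h : 'I_3 -> V -> R := fun i x =>
  nth 0 [:: partial c2 (h c3) x - partial c3 (h c2) x;
            partial c3 (h c1) x - partial c1 (h c3) x;
            partial c1 (h c2) x - partial c2 (h c1) x] i.

Definition divfree h := forall x, \sum_(j < 3) partial j (h j) x = 0.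

Lemma smoothB f g : smooth f -> smooth g -> smooth (fun x => f x - g x).
Proof.
move=> sf sg; have := smoothD sf (smoothZ (-1) sg).
by under [X in smooth X -> _]eq_fun do rewrite mulN1r.
Qed.

Lemma partialB f g j : smooth f -> smooth g ->
  partial j (fun x => f x - g x) = (fun x => partial j f x - partial j g x).
Proof.
move=> sf sg; have := partialD j (sf 1%N) (smoothZ (-1) sg 1%N).
rewrite partialZ//; under eq_fun do rewrite mulN1r.
by move=> ->; apply/funext => x; rewrite mulN1r.
Qed.

Lemma smooth_curl h : (forall i, smooth (h i)) -> forall i, smooth (curl h i).
Proof.
by move=> sh; apply: ord3_ind => /=; apply: smoothB; exact: smooth_partial.
Qed.

Lemma divfree_curl h : (forall i, smooth (h i)) -> divfree (curl h).
Proof.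
move=> sh x; rewrite sum3E /curl /=.
rewrite !partialB; try exact: smooth_partial.
rewrite (partial_comm c1 c2 (sh c3 2%N)) (partial_comm c1 c3 (sh c2 2%N)).
by rewrite (partial_comm c2 c3 (sh c1 2%N)); generalize_partials; ring.
Qed.

(** [curl curl = grad div - Delta]. *)
Lemma curl_curl h i x : (forall i, smooth (h i)) -> divfree h ->
  curl (curl h) i x = - laplacian (h i) x.
Proof.
move=> sh dh.
have sp j k : smooth (partial k (h j)) by exact: smooth_partial.
have dh' j : partial j (partial c1 (h c1)) x + partial j (partial c2 (h c2)) x +
    partial j (partial c3 (h c3)) x = 0.
  have : partial j (fun x => partial c1 (h c1) x + partial c2 (h c2) x +
    partial c3 (h c3) x) x = 0.
    rewrite (_ : (fun _ => _) = fun=> 0) ?partial_cst//.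
    by apply/funext => y; rewrite -[RHS](dh y) sum3E.
  rewrite partialD; [|by apply: CkD; exact: sp|exact: sp].
  by rewrite partialD; [|exact: sp|exact: sp].
have D1 := dh' c1; have D2 := dh' c2; have D3 := dh' c3.
rewrite (partial_comm c1 c2 (sh c2 2%N)) (partial_comm c1 c3 (sh c3 2%N)) in D1.
rewrite (partial_comm c2 c1 (sh c1 2%N)) (partial_comm c2 c3 (sh c3 2%N)) in D2.
rewrite (partial_comm c3 c1 (sh c1 2%N)) (partial_comm c3 c2 (sh c2 2%N)) in D3.
rewrite /laplacian sum3E.
move: i D1 D2 D3; apply: ord3_ind; rewrite /curl /= !partialB//;
  by generalize_partials; lra.
Qed.

Lemma partialZD a b f g j : smooth f -> smooth g ->
  partial j (fun x => a * f x + b * g x) =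
  (fun x => a * partial j f x + b * partial j g x).
Proof.
move=> sf sg; rewrite partialD; [|exact: CkZ (sf _)|exact: CkZ (sg _)].
by rewrite !partialZ; [|exact: sg|exact: sf].
Qed.

Lemma curlZD a b h u i x : (forall i, smooth (h i)) -> (forall i, smooth (u i)) ->
  curl (fun i x => a * h i x + b * u i x) i x = a * curl h i x + b * curl u i x.
Proof.
move=> sh su.
have P k j y : partial k (fun x => a * h j x + b * u j x) y =
    a * partial k (h j) y + b * partial k (u j) y.
  by rewrite partialZD.
by move: i; apply: ord3_ind; rewrite /curl /= !P; generalize_partials; ring.
Qed.

Lemma divfreeZD a b h u : (forall i, smooth (h i)) -> (forall i, smooth (u i)) ->
  divfree h -> divfree u -> divfree (fun i x => a * h i x + b * u i x).
Proof.
move=> sh su dh du x.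
have P j y : partial j (fun x => a * h j x + b * u j x) y =
    a * partial j (h j) y + b * partial j (u j) y.
  by rewrite partialZD.
under eq_bigr do rewrite P.
by rewrite big_split/= -!mulr_sumr dh du !mulr0 addr0.
Qed.

Definition beltrami (mu : R) u :=
  [/\ forall i, smooth (u i), divfree u & forall i x, curl u i x = mu * u i x].

(** With [curl (curl h) = lam^2 h], the curl of [lam h - curl h] is
    [lam curl h - lam^2 h]. *)
Lemma beltrami_of_helmholtz lam h : (forall i, smooth (h i)) -> divfree h ->
  (forall i, helmholtz (lam ^+ 2) (h i)) ->
  beltrami (- lam) (fun i x => lam * h i x + -1 * curl h i x).
Proof.
move=> sh dh eh; have sc := smooth_curl sh.
split.
- by move=> i; apply: smoothD; exact: smoothZ.
- by apply: divfreeZD => //; exact: divfree_curl.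
- by move=> i x; rewrite curlZD// curl_curl// eh; ring.
Qed.

Lemma beltramiZ mu c u : beltrami mu u -> beltrami mu (fun i x => c * u i x).
Proof.
move=> [su du cu].
have E : (fun i x => c * u i x) = (fun i x => c * u i x + 0 * u i x).
  by apply/funext => i; apply/funext => x; rewrite mul0r addr0.
rewrite E; split.
- by move=> i; apply: smoothD; exact: smoothZ.
- exact: divfreeZD.
- by move=> i x; rewrite curlZD// cu; ring.
Qed.

(** A divergence-free field with [curl u = mu u] has
    [- Delta u = curl (curl u) = mu^2 u]. *)
Lemma beltrami_laplacian mu u i x : beltrami mu u ->
  laplacian (u i) x = - mu ^+ 2 * u i x.
Proof.
move=> [su du cu]; rewrite -[LHS]opprK -curl_curl//.
have E : curl u = (fun i x => mu * u i x + 0 * u i x).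
  by apply/funext => j; apply/funext => y; rewrite cu mul0r addr0.
by rewrite E curlZD// cu; ring.
Qed.

Definition pressure u : V -> R := fun x =>
  - 2^-1 * (u c1 x * u c1 x + u c2 x * u c2 x + u c3 x * u c3 x).

(** [sum_j u_j d_j u_i - d_i (|u|^2 / 2) = sum_j u_j (d_j u_i - d_i u_j)] is a
    component of [curl u x u], which vanishes when [curl u] is parallel to [u]. *)
Lemma beltrami_advection mu u i x : beltrami mu u ->
  \sum_(j < 3) u j x * partial j (u i) x + partial i (pressure u) x = 0.
Proof.
move=> [su du cu].
have k2 j : Ck 1 (fun x => u j x * u j x) by apply: CkM; exact: su.
have P j : partial j (pressure u) x =
    - (u c1 x * partial j (u c1) x + u c2 x * partial j (u c2) x +
       u c3 x * partial j (u c3) x).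
  rewrite /pressure partialZ; last by apply: CkD => //; exact: CkD.
  rewrite partialD//; last exact: CkD.
  rewrite partialD// !partialM//; try exact: su.
  by field.
have := cu c1 x; have := cu c2 x; have := cu c3 x; rewrite /curl /= => C3 C2 C1.
rewrite sum3E P; move: i; apply: ord3_ind.
- rewrite (_ : partial c1 (u c2) x = mu * u c3 x + partial c2 (u c1) x);
    last by rewrite -C3; ring.
  rewrite (_ : partial c1 (u c3) x = partial c3 (u c1) x - mu * u c2 x);
      last by rewrite -C2; ring.
  by generalize_partials; ring.
- rewrite (_ : partial c2 (u c3) x = mu * u c1 x + partial c3 (u c2) x);
    last by rewrite -C1; ring.
  rewrite (_ : partial c2 (u c1) x = partial c1 (u c2) x - mu * u c3 x);
      last by rewrite -C3; ring.
  by generalize_partials; ring.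
- rewrite (_ : partial c3 (u c1) x = mu * u c2 x + partial c1 (u c3) x);
    last by rewrite -C2; ring.
  rewrite (_ : partial c3 (u c2) x = partial c2 (u c3) x - mu * u c1 x);
      last by rewrite -C1; ring.
  by generalize_partials; ring.
Qed.

Lemma Ck_pressure n u : (forall i, smooth (u i)) -> Ck n (pressure u).
Proof.
by move=> su; apply: CkZ; apply: CkD; [apply: CkD|]; apply: CkM; exact: su.
Qed.

End Fields.

(** * Stationary Euler and Navier-Stokes solutions from Beltrami fields *)

Section Solutions.
Variable R : realType.
Local Notation V := 'rV[R]_3.
Implicit Types (f : V -> R) (x : V) (i j : 'I_3) (u : 'I_3 -> V -> R).

Lemma beltrami_static_euler mu u (w : V -> V) :
  (forall i, component i w = u i) -> beltrami mu u ->
  static_euler_solution w (pressure u).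
Proof.
move=> wu bu; have [su du cu] := bu.
split=> [i| |x|x]; [by rewrite wu; exact: su|exact: Ck_pressure| |].
  apply/rowP => i; rewrite !mxE wu -[RHS](beltrami_advection i x bu).
  by congr (_ + _); apply: eq_bigr => j _; rewrite -[w x 0 j]/(component j w x) wu.
by rewrite /divergence -[RHS](du x); apply: eq_bigr => j _; rewrite wu.
Qed.

Lemma continuous_spacetime_sep (E : R -> R) f : continuous E -> continuous f ->
  continuous_spacetime (fun t x => E t * f x).
Proof.
move=> cE cf; apply: continuous_subspaceT; apply: continuous_mul => z.
- exact: (@cvg_comp _ _ _ fst E (nbhs z) (nbhs z.1) _ cvg_fst (cE z.1)).
- exact: (@cvg_comp _ _ _ snd f (nbhs z) (nbhs z.2) _ cvg_snd (cf z.2)).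
Qed.

Lemma is_derive_expRZ (c t : R) :
  is_derive t 1 (fun s : R => expR (- (c * s))) (- c * expR (- (c * t))).
Proof.
rewrite mulrC; apply: (@is_derive1_comp _ expR (fun s => - (c * s)) t).
under eq_fun do rewrite -mulNr; exact: is_derive_linear.
Qed.

(** At each time the field is a Beltrami field, hence a stationary Euler solution;
    the time derivative and the viscous term cancel separately. *)
Lemma beltrami_navier_stokes mu nu u (w : R -> V -> V) :
  (forall t i, component i (w t) = (fun x => expR (- (nu * mu ^+ 2 * t)) * u i x)) ->
  beltrami mu u ->
  navier_stokes_solution nu w
    (fun t => pressure (fun i x => expR (- (nu * mu ^+ 2 * t)) * u i x)).
Proof.
move=> wE bu; pose E t := expR (- (nu * mu ^+ 2 * t)).
rewrite -/(navier_stokes_solution nu w (fun t => pressure (fun i x => E t * u i x))).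
have wu t i : component i (w t) = (fun x => E t * u i x) by exact: wE.
have bt t : beltrami mu (fun i x => E t * u i x) by exact: beltramiZ.
have [su _ _] := bu.
have DE (t : R) : is_derive t 1 E (- (nu * mu ^+ 2) * E t) by exact: is_derive_expRZ.
have PE f j t : smooth f ->
    partial j (fun x => E t * f x) = (fun x => E t * partial j f x).
  by move=> sf; exact: partialZ (sf 1%N).
have cE : continuous E by exact: is_derive_continuous DE.
have Dt i (t : R) x : is_derive t 1 (fun s : R => E s * u i x)
    (- (nu * mu ^+ 2) * E t * u i x).
  have := is_derive_mulr (DE t) (is_derive_cst (u i x) t 1).
  by rewrite mulr0 add0r mulrC.
have dtE i : dt (fun t => component i (w t)) =
    fun t x => - (nu * mu ^+ 2) * E t * u i x.
  apply/funext => t; apply/funext => x; rewrite /dt derive1E.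
  under eq_fun do rewrite wu; exact: derive_val.
have ES t i : static_euler_solution (w t) (pressure (fun i x => E t * u i x)).
  exact: beltrami_static_euler (wu t) (bt t).
split.
- move=> i; split.
  + by move=> t _; rewrite wu; apply: CkZ; exact: su.
  + by move=> t x _; under eq_fun do rewrite wu; case: (Dt i t x).
  + split; last first.
      rewrite dtE; apply: (continuous_spacetime_sep (E := fun t =>
        - (nu * mu ^+ 2) * E t)).
        by apply: continuous_mul => //; exact: cst_continuous.
      exact: Ck_continuous (su i 0%N).
    under eq_fun do rewrite wu; apply: continuous_spacetime_sep => //.
    exact: Ck_continuous (su i 0%N).
  + move=> j; under eq_fun do rewrite wu (PE _ _ _ (su i)).
    apply: continuous_spacetime_sep => //.
    exact: Ck_continuous (smooth_partial j (su i) 0%N).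
  + move=> j k; under eq_fun do
      rewrite wu (PE _ _ _ (su i)) (PE _ _ _ (smooth_partial k (su i))).
    apply: continuous_spacetime_sep => //.
    exact: Ck_continuous (smooth_partial j (smooth_partial k (su i)) 0%N).
- by move=> t _; apply: Ck_pressure; case: (bt t).
- move=> t x _; have [_ _ + _] := ES t c1; move=> /(_ x) H.
  rewrite -addrA H addr0; apply/rowP => i.
  rewrite !mxE wu dtE (beltrami_laplacian i x (bt t)).
  by rewrite /=; ring.
- by move=> t x _; have [_ _ _] := ES t c1; exact.
Qed.

End Solutions.

Theorem theorem1p3 (R : realType) (A : 'I_3 -> mpoly.mpoly 3 R)
  (hA : perpendicular A)
  (lambda : nat -> R) (psi : nat -> 'rV[R]_3 -> R)
  (hlambda : forall n, (1 <= n)%N -> 0 <= lambda n)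
  (hpsi : forall n, (1 <= n)%N -> eigenfunction (lambda n) (psi n)) :
  let phi n := fun x : 'rV[R]_3 => lambda n * psi n x in
  let ue n := fun x : 'rV[R]_3 =>
    vecop A (phi n) x + vecop_cross A (psi n) x in
  let decay (nu : R) n (t : R) := expR (- (nu * lambda n ^+ 2 * t)) in
  let uns nu n := fun (t : R) (x : 'rV[R]_3) =>
    decay nu n t *: vecop A (phi n) x
    + decay nu n t *: vecop_cross A (psi n) x in
  (forall n, (1 <= n)%N ->
     [/\ forall x, ue n x
           = lambda n *: vecop A (psi n) x + vecop_cross A (psi n) x,
         exists P : 'rV[R]_3 -> R, static_euler_solution (ue n) P &
         periodic_2pi (ue n)])
  /\
  (forall nu : R, 0 < nu -> forall n, (1 <= n)%N ->
     [/\ forall t x, uns nu n t x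
           = (lambda n * decay nu n t) *: vecop A (psi n) x
             + decay nu n t *: vecop_cross A (psi n) x,
         exists P : R -> 'rV[R]_3 -> R, navier_stokes_solution nu (uns nu n) P,
         forall t, 0 <= t -> periodic_2pi (uns nu n t) &
         forall x, uns nu n 0 x = ue n x]).
Proof.
move=> phi ue decay uns.
pose H n i := polyop (A i) (psi n).
pose U n i x := lambda n * H n i x + -1 * curl (H n) i x.
have spsi n : (1 <= n)%N -> smooth (psi n) by move=> /hpsi; exact: eigenfunction_smooth.
have vphi n x : (1 <= n)%N -> vecop A (phi n) x = lambda n *: vecop A (psi n) x.
  by move=> n1; apply/rowP => i; rewrite !mxE polyopZ//; exact: spsi.
have ueU n i : (1 <= n)%N -> component i (ue n) = U n i.
  move=> n1; have sn := spsi n n1; apply/funext => x.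
  have E k l : polyop (A l) (partial k (psi n)) = partial k (H n l).
    by rewrite partial_polyop.
  rewrite /component mxE vphi// /U /curl !mxE !E.
  by congr (_ + _); move: i; apply: ord3_ind => /=; generalize_partials; ring.
have BU n : (1 <= n)%N -> beltrami (- lambda n) (U n).
  move=> n1; have sn := spsi n n1; apply: beltrami_of_helmholtz.
  - by move=> i; exact: smooth_polyop.
  - by move=> x; exact: divergence_free_polyop.
  - move=> i; apply: helmholtz_polyop => // x.
    by have [_ _ + _] := hpsi n n1; move=> /(_ x); rewrite mulNr => <-; rewrite opprK.
have unsE nu n t x : uns nu n t x = decay nu n t *: ue n x by rewrite /uns -scalerDr.
have pue n : (1 <= n)%N -> periodic_2pi (ue n).
  move=> n1; have [_ _ _ pn] := hpsi n n1; move=> x j.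
  rewrite /ue !vphi//; congr (_ *: _ + _); apply/rowP => i; rewrite !mxE.
    exact: periodic_polyop.
  have pp k l : periodic_2pi (polyop (A k) (partial l (psi n))).
    by apply: periodic_polyop; exact: periodic_partial.
  by congr (nth 0 [:: _ - _; _ - _; _ - _] _); exact: pp.
split=> [n n1|nu nu0 n n1].
  split=> [x| |]; [by rewrite /ue vphi| |exact: pue].
  exists (pressure (U n)).
  by apply: beltrami_static_euler (BU n n1) => i; exact: ueU.
split=> [t x| |t _|x].
- by rewrite /uns vphi// scalerA mulrC.
- exists (fun t => pressure (fun i x => decay nu n t * U n i x)).
  have := @beltrami_navier_stokes R (- lambda n) nu (U n) (uns nu n) _ (BU n n1).
  rewrite sqrrN; apply=> t i; apply/funext => x.
  by rewrite -ueU// /component unsE mxE.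
- by move=> x j; rewrite !unsE pue.
- by rewrite unsE /decay mulr0 oppr0 expR0 scale1r.
Qed.
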